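(* Let $\epsilon(x)$ be a positive-valued function of real $x\ge 2$ that tends to $0$ as $x\to\infty$. Let $a$ and $b$ be nonzero integers that are multiplicatively independent. Then for almost all primes $p$, at least one of $a$, $b$, $ab$, $a^2 b$, and $ab^2$ has multiplicative order modulo $p$ exceeding $$ p^{\frac{8}{15}+\epsilon(p)}. $$
   Context: Nonzero rational numbers $a_1,\dots,a_k$ are multiplicatively independent if whenever $a_1^{e_1}\cdots a_k^{e_k}=1$ with integers $e_1,\dots,e_k$, we have $e_1=\dots=e_k=0$. A statement holds for almost all primes $p$ if, as $x\to\infty$, the number of primes $p\le x$ for which it fails is $o(x/\log x)$. The multiplicative order of an integer modulo $p$ is considered only when $p$ does not divide the integer (here this excludes only the finitely many primes dividing $ab$). *)

(* Defs.v *)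
From mathcomp Require Import all_boot all_order all_algebra all_fingroup.
From mathcomp Require Import all_classical all_reals all_analysis.

Set Implicit Arguments.
Unset Strict Implicit.
Unset Printing Implicit Defensive.

Import Order.TTheory GRing.Theory Num.Theory.
Import numFieldNormedType.Exports.

Local Open Scope classical_set_scope.
Local Open Scope ring_scope.

(* Meant for tuples of nonzero rationals: x ^ n with x = 0 and n < 0 is the
   default value 0 of the library. *)
Definition mult_independent (k : nat) (a : k.-tuple rat) : Prop :=
  forall e : 'I_k -> int,
    \prod_(i < k) tnth a i ^ e i = 1 -> forall i, e i = 0.

(* For p prime and p not dividing a, the order of the class of a in the group
   (Z/pZ)^*.  If p divides a, the class of a is not a unit and insubd returns
   the default 1, so the value is meaningless there. *)
Definition mult_order (p : nat) (a : int) : nat :=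
  #[insubd (1%g : {unit 'F_p}) (a%:~R : 'F_p)]%g.

(* For x >= 0, p <= x is p < (truncn x).+1. *)
Definition exceptional_count (R : realType) (P : nat -> Prop) (x : R) : nat :=
  count (fun p => prime p && ~~ `[< P p >]) (iota 0 (Num.truncn x).+1).

(* x / ln x is positive for x > 1, so this limit says that the count is
   o(x / ln x). *)
Definition for_almost_all_primes (R : realType) (P : nat -> Prop) : Prop :=
  (exceptional_count P x)%:R / (x / ln x) @[x --> +oo] --> (0 : R).

(* Main.v *)
Require Import Defs.
From mathcomp Require Import all_boot all_order all_algebra all_fingroup.
From mathcomp Require Import all_solvable all_field.
From mathcomp Require Import all_classical all_reals all_analysis.
From mathcomp Require Import ring lra zify.
From mathcomp Require Import fintype finset.

Set Implicit Arguments.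
Unset Strict Implicit.
Unset Printing Implicit Defensive.

Import Order.TTheory GRing.Theory Num.Theory.
Import numFieldNormedType.Exports.

Local Open Scope ring_scope.

(** Let [N] be the order of the subgroup of [(Z/p)^*] generated by [a] and [b];
    it divides [p - 1].  The proof compares [N] with [p ^ (2/3)].

    From [N] to the five orders.  The exponent vectors [(1,0)], [(0,1)],
    [(1,1)], [(2,1)], [(1,2)] have pairwise determinants [+-1], [+-2], [+-3].
    Hence the indices of the five cyclic subgroups in the group of order [N]
    have pairwise gcd dividing 6; as all of them divide [N], their product is at
    most [6 ^ 10 * N], so the product of the five orders is at least
    [N ^ 4 / 6 ^ 10] ([prod_five_orders_ge]).  If no order exceeds
    [p ^ (8/15 + eps)], then [N] is at most [p ^ (2/3)] times a small power of
    [p] ([small_orders_small_pair]).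

    Small [N].  By pigeonhole on the elements [a ^ i * b ^ j] with
    [0 <= i, j <= H], an [N] below [(H + 1) ^ 2] makes [p] divide one of about
    [H ^ 2] integers with [O(H)] bits, none of them zero by independence.  So
    only [O(H ^ 3)] primes occur ([small_order_count]), a power of [x] less than
    [x] as soon as [N] is a power of [x] less than [x ^ (2/3)].

    [N] near [p ^ (2/3)].  Then [p - 1] has a divisor in a logarithmically short
    interval, and such [p] are rare by the idea behind the multiplication table
    problem of Erdos.  Put [y = x ^ delta] for a small [delta], let [R] be a
    fixed larger power of [y], and let [L] be the sum of [1 / q] over the primes
    of the window [(y, R]]; [L] is large with [1 / delta] ([window_mass_ge]).
    A typical [p - 1] has about [L] prime factors in the window.  Write
    [p - 1 = N * M] and let [m1], [m2] be the parts of [N], [M] free of primes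
    up to [y].  The part of [p - 1] made of primes up to [y] is usually at most
    [y ^ K] ([smooth_count]), so [m1] and [m2] lie in intervals
    [[y ^ al, y ^ be]] with [be - al = O(K)]; there, the integers without primes
    up to [y] have a sum of reciprocals that is only [O(K)] ([rough_sum_le]).
    For each such [m], the cofactor [(p - 1) / m] has about [L] prime factors in
    the window, outside a proportion [O(1 / L)] of the primes; summed over [m]
    the exceptions form a proportion [O(K / L)] ([rough_pair_count]).  For any
    other [p] both [M] and [N] have at least [3 * L / 4] prime factors in the
    window, and [p - 1] has at least [3 * L / 2], which is atypical
    ([atypical_factor]).

    The statements on typical cofactors are a Turan-Kubilius inequality in which
    the primes are majorized by Selberg's weight ([variance_le]).  Its main term
    is exact enough for the terms in [L ^ 2] to cancel, because removing one
    prime [q > y] from the sieve changes the quadratic form by a factor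
    [1 + O(1 / q)] ([sieve_form_le], [sieve_form1_ge]).  The estimates for sums
    over primes come from the factorization of [n!].

    All sizes are powers of an integer [y] that tends to infinity:
    [x] is about [y ^ (24 * u)], [R = y ^ u] and [u = 8 ^ J], with [K] and then
    [J] chosen large in terms of the proportion of exceptions to be beaten
    ([parameters_exist]). *)

(** * Sums over the subsets of a finite set *)

Section SubsetSums.
Variables (K : comNzRingType) (I : finType).
Implicit Types (A B C E T : {set I}).

Lemma sum_subset_prod (a : I -> K) B :
  \sum_(A : {set I} | A \subset B) \prod_(i in A) a i = \prod_(i in B) (1 + a i).
Proof.
pose G i := if i \in B then a i else 0.
have -> : \prod_(i in B) (1 + a i) = \prod_i (G i + 1).
  rewrite big_mkcond; apply: eq_bigr => i _; rewrite /G addrC.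
  by case: ifP; rewrite ?add0r.
rewrite bigA_distr [LHS]big_mkcond; apply: eq_big => [A|A _] /=; first by rewrite inE.
case: ifPn => [sAB|/subsetPn[i iA iB]].
  rewrite big_mkcond; apply: eq_bigr => i _.
  by case: ifP => // iA; rewrite /G (subsetP sAB _ iA).
by rewrite (bigD1 i) //= iA /G (negPf iB) mul0r.
Qed.

Lemma reindex_interval (g : {set I} -> K) E B : E \subset B ->
  \sum_(A : {set I} | (E \subset A) && (A \subset B)) g A =
  \sum_(C : {set I} | C \subset B :\: E) g (E :|: C).
Proof.
move=> sEB; rewrite (reindex_onto (fun C => E :|: C) (fun A => A :\: E)) /=; last first.
  move=> A /andP[sEA _]; apply/setP => i; rewrite !inE.
  by case: (boolP (i \in E)) => //= /(subsetP sEA) ->.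
apply: eq_bigl => C; rewrite subsetUl subUset sEB /= subsetD setDUl setDv set0U.
by congr (_ && _); apply/eqP/idP => [/setDidPl|/setDidPl].
Qed.

Lemma alternating_interval_sum E B : E \subset B ->
  \sum_(A : {set I} | (E \subset A) && (A \subset B)) (-1) ^+ #|A| =
  (-1) ^+ #|E| * (E == B)%:R :> K.
Proof.
move=> sEB; rewrite reindex_interval //.
have -> : (E == B) = (B :\: E == set0) by rewrite setD_eq0 eqEsubset sEB.
transitivity (\sum_(C : {set I} | C \subset B :\: E)
   (-1) ^+ #|E| * \prod_(i in C) (-1 : K)).
  apply: eq_bigr => C; rewrite subsetD => /andP[_ dis].
  have := leq_card_setU E C; rewrite disjoint_sym in dis.
  by rewrite dis => -[_ /eqP->]; rewrite prodr_const exprD.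
rewrite -mulr_sumr sum_subset_prod subrr prodr_const; congr (_ * _).
by rewrite -cards_eq0; case: #|_| => [|n]; rewrite ?expr0 ?expr0n.
Qed.
End SubsetSums.

(** * Selberg's quadratic form *)

Section Selberg.
Variables (K : realFieldType) (I : finType) (p : I -> nat).
Hypothesis p_gt1 : forall i, (1 < p i)%N.
Variable D : {set {set I}}.
Hypothesis D0 : set0 \in D.
Implicit Types (A B C E T : {set I}).
Hypothesis D_down : forall A B, A \subset B -> B \in D -> A \in D.

Definition subset_prod A : nat := \prod_(i in A) p i.
(** The inverse of Euler's totient at the product of [A]. *)
Definition inv_totient A : K := \prod_(i in A) ((p i)%:R - 1)^-1.
Definition sieve_mass : K := \sum_(A in D) inv_totient A.
(** Selberg's optimal coefficient.  Squarefree integers are encoded by sets of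
    primes, so that the Moebius function is [(-1) ^+ #|A|] and gcd and lcm are
    the intersection and the union. *)
Definition sieve_coef A : K :=
  (-1) ^+ #|A| * (subset_prod A)%:R * (\sum_(B in D | A \subset B) inv_totient B) / sieve_mass.
(** The mean of the sieve weight over the multiples of the product of [T], see
    [sieve_weight_sum]. *)
Definition sieve_form T : K := \sum_(A : {set I} | [disjoint A & T])
  \sum_(B : {set I} | [disjoint B & T]) sieve_coef A * sieve_coef B / (subset_prod (A :|: B))%:R.

Lemma pm1_gt0 i : 0 < (p i)%:R - 1 :> K.
Proof. by rewrite subr_gt0 ltr1n. Qed.

Lemma inv_totient_gt0 A : 0 < inv_totient A.
Proof. by apply: prodr_gt0 => i _; rewrite invr_gt0 pm1_gt0. Qed.

Lemma inv_totient0 : inv_totient set0 = 1.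
Proof. by rewrite /inv_totient big_set0. Qed.

Lemma inv_totientU A B : [disjoint A & B] -> inv_totient (A :|: B) = inv_totient A * inv_totient B.
Proof.
move=> dis; rewrite /inv_totient (big_setID A) /= setUK setDUl setDv set0U.
by have /setDidPl -> : [disjoint B & A] by rewrite disjoint_sym.
Qed.

Lemma subset_prod_gt0 A : (0 < subset_prod A)%N.
Proof. by apply: prodn_gt0 => i; apply: ltnW. Qed.

Lemma sieve_mass_ge1 : 1 <= sieve_mass.
Proof.
rewrite /sieve_mass (bigD1 set0) //= inv_totient0 lerDl.
by apply: sumr_ge0 => A _; apply/ltW/inv_totient_gt0.
Qed.

Lemma sieve_mass_gt0 : 0 < sieve_mass.
Proof. exact: lt_le_trans ltr01 sieve_mass_ge1. Qed.

Lemma sieve_coef0 : sieve_coef set0 = 1.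
Proof.
rewrite /sieve_coef cards0 expr0 /subset_prod big_set0 !mul1r.
have -> : \sum_(B in D | set0 \subset B) inv_totient B = sieve_mass.
  by apply: eq_bigl => B; rewrite sub0set andbT.
by rewrite divff // gt_eqF // sieve_mass_gt0.
Qed.

Lemma sieve_coef_out A : A \notin D -> sieve_coef A = 0.
Proof.
move=> AD; rewrite /sieve_coef big_pred0 ?mulr0 ?mul0r // => B.
by apply/negP => /andP[BD sAB]; rewrite (D_down sAB BD) in AD.
Qed.

(** The inner sum is part of [sieve_mass].  This trivial bound is enough when the
    level of the sieve is a small power of the length. *)
Lemma sieve_coef_le A : `|sieve_coef A| <= (subset_prod A)%:R.
Proof.
have s0 : 0 <= \sum_(B in D | A \subset B) inv_totient B.
  by apply: sumr_ge0 => B _; apply/ltW/inv_totient_gt0.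
rewrite /sieve_coef !normrM normrX normrN1 expr1n mul1r normfV !ger0_norm //; last exact/ltW/sieve_mass_gt0.
rewrite -mulrA ler_piMr // ler_pdivrMr ?sieve_mass_gt0 // mul1r.
rewrite /sieve_mass [X in _ <= X](bigID (fun B => A \subset B)) /= lerDl.
by apply: sumr_ge0 => B _; apply/ltW/inv_totient_gt0.
Qed.

Lemma subset_prod_expand A :
  (subset_prod A)%:R = \sum_(E : {set I} | E \subset A) \prod_(i in E) ((p i)%:R - 1) :> K.
Proof.
rewrite sum_subset_prod /subset_prod natr_prod; apply: eq_bigr => i _; ring.
Qed.

Lemma subset_prodUI A B : (subset_prod (A :|: B) * subset_prod (A :&: B) = subset_prod A * subset_prod B)%N.
Proof.
have e1 : subset_prod (A :|: B) = (subset_prod A * subset_prod (B :\: A))%N.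
  by rewrite /subset_prod (big_setID A) /= setUK setDUl setDv set0U.
have e2 : subset_prod B = (subset_prod (B :&: A) * subset_prod (B :\: A))%N.
  by rewrite /subset_prod (big_setID A).
by rewrite e1 e2 setIC; lia.
Qed.

(** The change of variables that diagonalizes the quadratic form.  By Moebius
    inversion only the sets [B] of the support that agree with [E] outside [T]
    survive. *)
Lemma sieve_coef_quotient_sum T E : [disjoint E & T] ->
  \sum_(A : {set I} | (E \subset A) && [disjoint A & T]) sieve_coef A / (subset_prod A)%:R =
  (-1) ^+ #|E| * (\sum_(B in D | B :\: T == E) inv_totient B) / sieve_mass.
Proof.
move=> dET.
transitivity (\sum_(A : {set I} | (E \subset A) && [disjoint A & T])
   \sum_(B in D | A \subset B) (-1) ^+ #|A| * (inv_totient B / sieve_mass)).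
  apply: eq_bigr => A _; rewrite -mulr_sumr -mulr_suml /sieve_coef.
  have fA : (subset_prod A)%:R != 0 :> K by rewrite pnatr_eq0 -lt0n subset_prod_gt0.
  by field; rewrite fA gt_eqF // sieve_mass_gt0.
rewrite (exchange_big_dep (mem D)) /=; last by move=> A B _ /andP[].
transitivity (\sum_(B in D)
   (if E \subset B then (-1) ^+ #|E| * (E == B :\: T)%:R * (inv_totient B / sieve_mass) else 0)).
  apply: eq_bigr => B BD; rewrite BD /=; case: ifPn => [sEB|/negP nEB].
    have sEBT : E \subset B :\: T by rewrite subsetD sEB.
    rewrite -alternating_interval_sum // mulr_suml; apply: eq_bigl => A.
    by rewrite subsetD -!andbA; congr (_ && _); rewrite andbC.
  by rewrite big_pred0 // => A; apply/negP => /andP[/andP[sEA _]] /(subset_trans sEA).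
rewrite -big_mkcondr /= (bigID (fun B => B :\: T == E)) /= [X in _ + X]big1 ?addr0; last first.
  by move=> B /andP[_ /negPf]; rewrite eq_sym => ->; rewrite mulr0 mul0r.
rewrite mulr_sumr mulr_suml; apply: eq_big => [B|B /andP[_ /eqP->]]; last by rewrite eqxx mulr1 mulrA.
case: eqP => [<-|]; rewrite ?andbF // subsetDl //; last by rewrite !andbT.
Qed.

(** As lcm times gcd is the product, the form is a sum over the common subsets
    [E] of [A] and [B], weighted by the totient of [E]; it becomes a sum of
    squares. *)
Lemma sieve_form_diag T : sieve_form T = \sum_(E : {set I} | [disjoint E & T])
  (\prod_(i in E) ((p i)%:R - 1)) * ((\sum_(B in D | B :\: T == E) inv_totient B) / sieve_mass) ^+ 2.
Proof.
have sq E : [disjoint E & T] ->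
    ((\sum_(B in D | B :\: T == E) inv_totient B) / sieve_mass) ^+ 2 =
    (\sum_(A : {set I} | (E \subset A) && [disjoint A & T]) sieve_coef A / (subset_prod A)%:R) ^+ 2.
  by move=> dET; rewrite sieve_coef_quotient_sum // -mulrA [RHS]exprMn sqrr_sign mul1r.
have nz X : (subset_prod X)%:R != 0 :> K by rewrite pnatr_eq0 -lt0n subset_prod_gt0.
pose a A := if [disjoint A & T] then sieve_coef A / (subset_prod A)%:R else 0.
pose phi E := \prod_(i in E) ((p i)%:R - 1) : K.
transitivity (\sum_(A : {set I}) \sum_(B : {set I}) \sum_(E : {set I})
    phi E * ((E \subset A)%:R * a A) * ((E \subset B)%:R * a B)).
  rewrite /sieve_form big_mkcond; apply: eq_bigr => A _; rewrite /a.
  case: ifP => dA; last first.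
    by rewrite big1 // => B _; rewrite big1 // => E _; rewrite !mulr0 mul0r.
  rewrite big_mkcond; apply: eq_bigr => B _; case: ifP => dB; last first.
    by rewrite big1 // => E _; rewrite !mulr0.
  transitivity (\sum_(E : {set I} | E \subset A :&: B)
     phi E * ((sieve_coef A / (subset_prod A)%:R) * (sieve_coef B / (subset_prod B)%:R))).
    rewrite -mulr_suml -subset_prod_expand.
    have := congr1 (fun n => n%:R : K) (subset_prodUI A B); rewrite !natrM => e.
    have -> : (subset_prod (A :&: B))%:R = (subset_prod A)%:R * (subset_prod B)%:R / (subset_prod (A :|: B))%:R :> K.
      by rewrite -e mulrAC divff ?mul1r.
    by field; rewrite !nz.
  rewrite big_mkcond; apply: eq_bigr => E _; rewrite subsetI.
  by case: (E \subset A); case: (E \subset B) => /=; ring.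
rewrite [RHS]big_mkcond /=.
under eq_bigr => A _ do rewrite exchange_big /=.
rewrite exchange_big /=; apply: eq_bigr => E _.
transitivity (phi E * (\sum_(A : {set I}) (E \subset A)%:R * a A) ^+ 2).
  rewrite expr2 mulr_suml mulr_sumr; apply: eq_bigr => A _.
  by rewrite !mulr_sumr; apply: eq_bigr => B _; rewrite !mulrA.
case: ifP => dE.
  rewrite sq //; congr (_ * _ ^+ 2); rewrite [RHS]big_mkcond; apply: eq_bigr => A _.
  by rewrite /a; case: (E \subset A); case: ifP; rewrite ?mul1r ?mul0r ?mulr0.
rewrite big1 ?expr0n ?mulr0 // => A _; rewrite /a.
case: (boolP (E \subset A)) => sEA; last by rewrite mul0r.
case: ifP => dA; last by rewrite mulr0.
by rewrite (disjointWl sEA dA) in dE.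
Qed.

(** [Q / phi Q] for the product [Q] of [T]. *)
Definition euler_factor T : K := \prod_(i in T) (1 + ((p i)%:R - 1)^-1).

Lemma totient_mul_inv E : \prod_(i in E) ((p i)%:R - 1) * inv_totient E = 1.
Proof.
rewrite /inv_totient -big_split big1 // => i _.
by rewrite /= divff // gt_eqF // pm1_gt0.
Qed.

Lemma totient_prod_ge0 E : 0 <= \prod_(i in E) ((p i)%:R - 1) :> K.
Proof. by apply: prodr_ge0 => i _; apply/ltW/pm1_gt0. Qed.

(** A set that agrees with [E] outside [T] is [E] together with a subset of
    [T]. *)
Lemma sum_inv_totient_fiber_le T E : [disjoint E & T] ->
  \sum_(B in D | B :\: T == E) inv_totient B <= (E \in D)%:R * (inv_totient E * euler_factor T).
Proof.
move=> dET; have [ED|nED] := boolP (E \in D); last first.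
  rewrite mul0r big_pred0 // => B; apply/negP => /andP[BD /eqP eE].
  by move/negP: nED; apply; apply: D_down BD; rewrite -eE subsetDl.
rewrite mul1r; apply: (@le_trans _ _ (\sum_(B : {set I} | B :\: T == E) inv_totient B)).
  rewrite big_mkcondl /=; apply: ler_sum => B _.
  by case: ifP => // _; apply/ltW/inv_totient_gt0.
have e B : (B :\: T == E) = (E \subset B) && (B \subset E :|: T).
  apply/eqP/andP => [<-|[sEB sB]].
    by rewrite subsetDl setUC -subDset subxx.
  apply/eqP; rewrite eqEsubset subsetD sEB dET andbT.
  by rewrite andbT subDset setUC.
rewrite (eq_bigl _ _ e) reindex_interval ?subsetUl //.
have eT : (E :|: T) :\: E = T.
  by rewrite setDUl setDv set0U; apply/setDidPl; rewrite disjoint_sym.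
rewrite eT /euler_factor -sum_subset_prod mulr_sumr; apply: ler_sum => C sCT.
by rewrite inv_totientU // disjoint_sym (disjointWl sCT) // disjoint_sym.
Qed.

(** With [T] empty this is Selberg's bound; in general the removal of [T] from the
    sieve costs at most the square of its Euler factor. *)
Lemma sieve_form_le T : sieve_form T <= euler_factor T ^+ 2 / sieve_mass.
Proof.
have eT0 : 0 <= euler_factor T.
  by apply: prodr_ge0 => i _; rewrite addr_ge0 // invr_ge0 ltW // pm1_gt0.
rewrite sieve_form_diag.
apply: (@le_trans _ _ (\sum_(E in D) inv_totient E * (euler_factor T / sieve_mass) ^+ 2)); last first.
  rewrite -mulr_suml -/sieve_mass; have G0 : sieve_mass != 0 by rewrite gt_eqF // sieve_mass_gt0.
  by have -> : sieve_mass * (euler_factor T / sieve_mass) ^+ 2 = euler_factor T ^+ 2 / sieve_mass by field.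
rewrite big_mkcond [X in _ <= X]big_mkcond /=; apply: ler_sum => E _.
have q0 : 0 <= (euler_factor T / sieve_mass) ^+ 2 by apply: sqr_ge0.
case: ifP => dET; last by case: ifP => // _; rewrite mulr_ge0 //; apply/ltW/inv_totient_gt0.
have := sum_inv_totient_fiber_le dET; set S := \sum_(_ in _ | _) _ => leS.
have S0 : 0 <= S by apply: sumr_ge0 => B _; apply/ltW/inv_totient_gt0.
case: ifP leS => ED leS; last first.
  by rewrite mul0r in leS; have /eqP -> : S == 0 by [rewrite eq_le leS S0]; rewrite mul0r expr0n mulr0.
rewrite mul1r in leS.
apply: (@le_trans _ _ (\prod_(i in E) ((p i)%:R - 1) * (inv_totient E * euler_factor T / sieve_mass) ^+ 2)).
  apply: ler_wpM2l; first exact: totient_prod_ge0.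
  rewrite lerXn2r ?nnegrE //.
  - by rewrite divr_ge0 // ltW // sieve_mass_gt0.
  - by rewrite divr_ge0 ?mulr_ge0 // ltW // ?inv_totient_gt0 ?sieve_mass_gt0.
  - by rewrite ler_pM2r ?invr_gt0 ?sieve_mass_gt0.
rewrite -[inv_totient E * _ / _]mulrA exprMn [inv_totient E ^+ 2]expr2 !mulrA totient_mul_inv mul1r.
exact: lexx.
Qed.

Lemma sieve_form1_ge i : (1 - ((p i)%:R - 1)^-1) / sieve_mass <= sieve_form [set i].
Proof.
rewrite sieve_form_diag.
apply: (@le_trans _ _ (\sum_(E in D | i \notin E) inv_totient E / sieve_mass ^+ 2)).
  rewrite -mulr_suml expr2 invfM mulrA ler_pM2r ?invr_gt0 ?sieve_mass_gt0 //.
  rewrite ler_pdivlMr ?sieve_mass_gt0 // mulrBl mul1r lerBlDl.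
  rewrite [X in X <= _](bigID (fun E : {set I} => i \in E)) /= lerD2r.
  rewrite (reindex_onto (fun A => i |: A) (fun E => E :\ i)) /=; last first.
    by move=> A /andP[_ iA]; rewrite setD1K.
  rewrite /sieve_mass mulr_sumr big_mkcond [X in _ <= X]big_mkcond /=.
  have h0 : 0 < ((p i)%:R - 1)^-1 :> K by rewrite invr_gt0 pm1_gt0.
  apply: ler_sum => A _; case: ifP => [/andP[/andP[AD _]]|_].
    have [iA|iA _] := boolP (i \in A).
      by move=> /eqP/setP/(_ i); rewrite !inE eqxx /= iA.
    rewrite (D_down (subsetUr [set i] A) AD) inv_totientU ?disjoints1 // {1}/inv_totient big_set1.
    exact: lexx.
  by case: ifP => // _; rewrite mulr_ge0 // ltW // inv_totient_gt0.
rewrite big_mkcond [X in _ <= X]big_mkcond /=; apply: ler_sum => E _.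
rewrite disjoint_sym disjoints1; case: ifPn => [/andP[ED iE]|_].
  rewrite iE exprMn exprVn mulrA ler_pM2r ?invr_gt0 ?exprn_gt0 ?sieve_mass_gt0 //.
  apply: (@le_trans _ _ (\prod_(i0 in E) ((p i0)%:R - 1) * inv_totient E ^+ 2)).
    by rewrite expr2 mulrA totient_mul_inv mul1r.
  apply: ler_wpM2l; first exact: totient_prod_ge0.
  rewrite (bigD1 E) /=; last first.
    by rewrite ED /=; apply/eqP/setDidPl; rewrite disjoint_sym disjoints1.
  have s0 : 0 <= \sum_(B in D | (B :\: [set i] == E) && (B != E)) inv_totient B.
    by apply: sumr_ge0 => B _; apply/ltW/inv_totient_gt0.
  rewrite (eq_bigl (fun B => (B \in D) && ((B :\: [set i] == E) && (B != E)))); last first.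
    by move=> B; rewrite andbA.
  by rewrite lerXn2r ?nnegrE ?addr_ge0 ?lerDl ?(ltW (inv_totient_gt0 _)).
case: ifP => // _; rewrite mulr_ge0 ?totient_prod_ge0 // sqr_ge0 //.
Qed.
End Selberg.

(** * Solutions of a linear congruence *)

Lemma count_residue (d r X : nat) : (r < d)%N ->
  (\sum_(0 <= e < X | e == r %[mod d]) 1 = (X + (d.-1 - r)) %/ d)%N.
Proof.
move=> ltrd; have d0 : (0 < d)%N by apply: leq_ltn_trans ltrd.
elim: X => [|X IH].
  by rewrite big_geq // divn_small // add0n; lia.
rewrite big_mkcond big_nat_recr //= -big_mkcond /= IH addSn divnS // addnC.
congr (_ + _)%N.
have -> : (X + (d.-1 - r)).+1 = (X + (d - r))%N by lia.
have -> : (d %| X + (d - r))%N = (X == r %[mod d]); last by case: ifP.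
rewrite -[RHS](eqn_modDr (d - r)) subnKC ?(ltnW ltrd) // modnn.
by rewrite /dvdn.
Qed.

Lemma count_residue_approx (K : realFieldType) (d r X : nat) : (0 < d)%N ->
  `|(\sum_(0 <= e < X | e == r %[mod d]) 1)%:R - X%:R / d%:R| <= 1 :> K.
Proof.
move=> d0; under eq_bigl do rewrite -(modn_mod r).
rewrite count_residue ?ltn_mod //.
set c := (d.-1 - _)%N; have cd : (c < d)%N by rewrite /c; lia.
have dK : 0 < d%:R :> K by rewrite ltr0n.
have e := divn_eq (X + c) d; have l := ltn_pmod (X + c) d0.
set k := ((X + c) %/ d)%N in e *.
have h1 : (k * d <= X + d)%N by lia.
have h2 : (X <= k * d + d)%N by lia.
rewrite -(ler_nat K) !natrD !natrM in h1; rewrite -(ler_nat K) !natrD !natrM in h2.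
have : X%:R / d%:R * d%:R = X%:R :> K by rewrite divfK // gt_eqF.
set t := X%:R / _ => tE.
by rewrite ler_norml; apply/andP; split; rewrite -(ler_pM2r dK); lra.
Qed.

(** By the Chinese remainder theorem the conditions select one class modulo
    [Q * d]. *)
Lemma count_linear (K : realFieldType) (M Q d X : nat) : (0 < Q)%N -> (0 < d)%N ->
  coprime d (M * Q) ->
  `|(\sum_(0 <= e < X | (Q %| e) && (d %| M * e + 1)) 1)%N%:R - X%:R / (Q%:R * d%:R)| <= 1 :> K.
Proof.
move=> Q0 d0 co.
have coM : coprime d M by move: co; rewrite coprimeMr => /andP[].
have coQ : coprime Q d by move: co; rewrite coprimeMr coprime_sym => /andP[_]; rewrite coprime_sym.
have [r Qr dr] : exists2 r, (Q %| r)%N & (d %| M * r + 1)%N.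
  have co' : coprime (M * Q) d by rewrite coprime_sym.
  pose n := chinese (M * Q) d 0 d.-1.
  have h1 : (M * Q %| n)%N by rewrite /dvdn /n chinese_modl // mod0n.
  have h2 : (n + 1 = 0 %[mod d])%N by rewrite -modnDml /n chinese_modr // modnDml addn1 prednK // modnn mod0n.
  case/dvdnP: h1 => k nE; exists (k * Q)%N; first exact: dvdn_mull.
  have -> : (M * (k * Q) + 1 = n + 1)%N by rewrite nE; lia.
  by rewrite /dvdn h2 mod0n.
rewrite -natrM.
have -> : (\sum_(0 <= e < X | (Q %| e) && (d %| M * e + 1)) 1 =
           \sum_(0 <= e < X | e == r %[mod Q * d]) 1)%N.
  apply: eq_bigl => e; rewrite chinese_remainder //; congr (_ && _).
    by rewrite /dvdn; move: Qr; rewrite /dvdn => /eqP ->.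
  have -> : (d %| M * e + 1)%N = (M * e + 1 == M * r + 1 %[mod d]).
    by move: dr; rewrite /dvdn => /eqP ->.
  rewrite eqn_modDr.
  have [le_re|/ltnW le_er] := leqP r e.
    by rewrite !eqn_mod_dvd ?leq_mul2l ?le_re ?orbT // -mulnBr Gauss_dvdr.
  by rewrite eq_sym [RHS]eq_sym !eqn_mod_dvd ?leq_mul2l ?le_er ?orbT // -mulnBr Gauss_dvdr.
by apply: count_residue_approx; rewrite muln_gt0 Q0.
Qed.

(** * Selberg's weight for the primes in a progression *)

Definition prime_upto (R : nat) := {i : 'I_R.+1 | prime i}.
Definition prime_val (R : nat) (i : prime_upto R) : nat := val (val i).
Definition sieve_supp (R M : nat) : {set {set prime_upto R}} :=
  [set A | coprime (subset_prod (@prime_val R) A) M && (subset_prod (@prime_val R) A <= R)%N].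

Section SievePrimes.
Variables (R : nat).
Local Notation prime_val := (@prime_val R).
Local Notation subset_prod := (subset_prod prime_val).
Implicit Types (A B T : {set prime_upto R}).

Lemma prime_val_prime i : prime (prime_val i).
Proof. exact: valP i. Qed.

Lemma prime_val_gt1 i : (1 < prime_val i)%N.
Proof. exact/prime_gt1/prime_val_prime. Qed.

Lemma prime_val_inj : injective prime_val.
Proof. by move=> i j /val_inj/val_inj. Qed.

Lemma prime_uptoP q : prime q -> (q <= R)%N -> exists i, prime_val i = q.
Proof.
move=> pq qR; have qR' : (q < R.+1)%N by [].
by exists (exist (fun i : 'I_R.+1 => prime i) (Ordinal qR') pq).
Qed.

Lemma subset_prod_dvdE A n : (subset_prod A %| n)%N = [forall (i | i \in A), (prime_val i %| n)%N].
Proof.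
have [m cA] := ubnP #|A|; elim: m A cA => // m IH A cA.
have [->|[i iA]] := set_0Vmem A.
  by rewrite /subset_prod big_set0 dvd1n; symmetry; apply/forall_inP => i; rewrite inE.
have -> : subset_prod A = (prime_val i * subset_prod (A :\ i))%N.
  by rewrite /subset_prod (big_setD1 i).
rewrite Gauss_dvd; last first.
  rewrite prime_coprime ?prime_val_prime // /subset_prod Euclid_dvd_prod ?prime_val_prime //.
  rewrite big_has_cond; apply/hasPn => j _; rewrite !inE negb_and negb_and negbK.
  case: eqP => //= /eqP ji; rewrite dvdn_prime2 ?prime_val_prime //.
  by rewrite (inj_eq prime_val_inj) eq_sym (negPf ji) orbT.
rewrite IH; last by move: cA; rewrite (cardsD1 i) iA.
apply/andP/forall_inP => [[di /forall_inP dA] j jA|h].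
  by have [->//|ji] := eqVneq j i; apply: dA; rewrite !inE ji.
by split; [exact: h|apply/forall_inP => j; rewrite !inE => /andP[_]; exact: h].
Qed.

Lemma prime_val_dvd i A : (prime_val i %| subset_prod A)%N = (i \in A).
Proof.
apply/idP/idP => [|iA]; last by rewrite /subset_prod (big_setD1 i) //= dvdn_mulr.
rewrite /subset_prod Euclid_dvd_prod ?prime_val_prime // big_has_cond => /hasP[j _ /andP[jA]].
by rewrite dvdn_prime2 ?prime_val_prime // => /eqP/prime_val_inj ->.
Qed.

Lemma subset_prod_inj : injective subset_prod.
Proof. by move=> A B e; apply/setP => i; rewrite -!prime_val_dvd e. Qed.

Lemma subset_prod_dvdU A B n : (subset_prod (A :|: B) %| n)%N = (subset_prod A %| n)%N && (subset_prod B %| n)%N.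
Proof.
rewrite !subset_prod_dvdE; apply/forall_inP/andP => [h|[/forall_inP hA /forall_inP hB] i].
  by split; apply/forall_inP => i iA; apply: h; rewrite inE iA ?orbT.
by rewrite inE => /orP[/hA|/hB].
Qed.

Lemma subset_prodS A B : A \subset B -> (subset_prod A %| subset_prod B)%N.
Proof.
move=> sAB; rewrite subset_prod_dvdE; apply/forall_inP => i iA.
by rewrite prime_val_dvd (subsetP sAB).
Qed.

Lemma subset_prod_coprime A n : coprime (subset_prod A) n = [forall (i | i \in A), ~~ (prime_val i %| n)%N].
Proof.
apply/idP/forall_inP => [co i iA|h].
  by rewrite -prime_coprime ?prime_val_prime //; apply: coprime_dvdl co; rewrite prime_val_dvd.
rewrite /subset_prod; elim/big_rec: _ => [|i x iA IH]; first exact: coprime1n.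
by rewrite coprimeMl prime_coprime ?prime_val_prime // h.
Qed.

Variable M : nat.
Local Notation sieve_supp := (sieve_supp R M).

Hypothesis R_gt0 : (0 < R)%N.

Lemma sieve_supp0 : set0 \in sieve_supp.
Proof. by rewrite inE /subset_prod big_set0 coprime1n. Qed.

Lemma sieve_supp_down A B : A \subset B -> B \in sieve_supp -> A \in sieve_supp.
Proof.
move=> sAB; rewrite !inE => /andP[co le]; have d := subset_prodS sAB.
rewrite (coprime_dvdl d co) /=; apply: leq_trans le; apply: dvdn_leq d.
exact: subset_prod_gt0 prime_val_gt1 _.
Qed.

(** Distinct sets of primes have distinct products, all in [[1, R]]. *)
Lemma card_sieve_supp : (#|sieve_supp| <= R)%N.
Proof.
rewrite cardE -(size_map subset_prod) -[R in (_ <= R)%N](size_iota 1).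
apply: uniq_leq_size; first by rewrite map_inj_uniq ?enum_uniq //; apply: subset_prod_inj.
move=> n /mapP[A]; rewrite mem_enum inE => /andP[_ le] ->.
by rewrite mem_iota subset_prod_gt0 ?add1n //; apply: prime_val_gt1.
Qed.

Variable K : realFieldType.
Local Notation sieve_coef := (sieve_coef K prime_val sieve_supp).
Local Notation sieve_mass := (sieve_mass K prime_val sieve_supp).
Local Notation sieve_form := (sieve_form K prime_val sieve_supp).

Lemma sum_sieve_coef_le : \sum_(A : {set prime_upto R}) `|sieve_coef A| <= R%:R ^+ 2.
Proof.
rewrite (bigID (mem sieve_supp)) /= [X in _ + X]big1 ?addr0; last first.
  by move=> A; move/(sieve_coef_out K prime_val sieve_supp_down) => ->; rewrite normr0.
apply: (@le_trans _ _ (\sum_(A in sieve_supp) R%:R)).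
  apply: ler_sum => A; rewrite inE => /andP[_ le].
  by apply: (le_trans (sieve_coef_le K prime_val_gt1 sieve_supp0 A)); rewrite ler_nat.
by rewrite sumr_const -[X in X <= _]mulr_natr expr2 ler_wpM2l // ler_nat card_sieve_supp.
Qed.

(** A majorant of the indicator of the primes above [R], used at
    [n = M * e + 1]. *)
Definition sieve_weight (n : nat) : K := (\sum_(A | (subset_prod A %| n)%N) sieve_coef A) ^+ 2.

Lemma sieve_weight_prime n : prime n -> (R < n)%N -> sieve_weight n = 1.
Proof.
move=> pn Rn; rewrite /sieve_weight (bigD1 set0) /=; last by rewrite /subset_prod big_set0.
rewrite big1 ?addr0 ?sieve_coef0 ?expr1n //.
- exact: prime_val_gt1.
- exact: sieve_supp0.
move=> A /andP[dA A0]; have [i iA] := set0Pn _ A0.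
have : (prime_val i %| n)%N by move: dA; rewrite subset_prod_dvdE => /forall_inP; apply.
rewrite dvdn_prime2 ?prime_val_prime // => /eqP e.
by have := ltn_ord (val i); rewrite -[nat_of_ord _]/(prime_val i) e ltnS leqNgt Rn.
Qed.

(** The weight is equidistributed on the multiples of [Q]: the error is at most the
    square of the sum of the coefficients.  A divisor of [M * e + 1] that shares
    a prime with a divisor [Q] of [e] does not occur, whence the restriction to
    sets disjoint from the primes of [Q]. *)
Lemma sieve_weight_sum (Q X : nat) : (0 < Q)%N ->
  `|\sum_(0 <= e < X | (Q %| e)%N) sieve_weight (M * e + 1) -
    X%:R / Q%:R * sieve_form [set i | prime_val i %| Q]%N| <= R%:R ^+ 4.
Proof.
move=> Q0; set T := [set i | _].
pose N A B : nat := (\sum_(0 <= e < X | (Q %| e) && (subset_prod (A :|: B) %| M * e + 1)) 1)%N.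
have -> : \sum_(0 <= e < X | (Q %| e)%N) sieve_weight (M * e + 1) =
    \sum_(A : {set prime_upto R}) \sum_(B : {set prime_upto R}) sieve_coef A * sieve_coef B * (N A B)%:R.
  transitivity (\sum_(0 <= e < X | (Q %| e)%N) \sum_(A : {set prime_upto R}) \sum_(B : {set prime_upto R})
      sieve_coef A * sieve_coef B * (subset_prod (A :|: B) %| M * e + 1)%N%:R).
    apply: eq_bigr => e _; rewrite /sieve_weight expr2 mulr_suml big_mkcond /=.
    apply: eq_bigr => A _; case: ifP => dA; last first.
      by rewrite big1 // => B _; rewrite subset_prod_dvdU dA mulr0.
    rewrite mulr_sumr big_mkcond; apply: eq_bigr => B _.
    by rewrite subset_prod_dvdU dA; case: ifP; rewrite ?mulr1 ?mulr0.
  rewrite exchange_big; apply: eq_bigr => A _.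
  rewrite exchange_big; apply: eq_bigr => B _.
  rewrite -mulr_sumr /N natr_sum big_mkcondr; congr (_ * _); apply: eq_bigr => e _.
  by case: ifP.
have -> : X%:R / Q%:R * sieve_form T = \sum_(A : {set prime_upto R}) \sum_(B : {set prime_upto R})
    sieve_coef A * sieve_coef B * (([disjoint A & T] && [disjoint B & T])%:R *
                     (X%:R / (Q%:R * (subset_prod (A :|: B))%:R))).
  rewrite /sieve_form mulr_sumr big_mkcond; apply: eq_bigr => A _.
  case: ifP => dA; last by rewrite big1 // => B _; rewrite /= mul0r mulr0.
  rewrite mulr_sumr big_mkcond; apply: eq_bigr => B _.
  by case: ifP => dB; rewrite /= ?mul0r ?mulr0 // mul1r invfM; ring.
rewrite -sumrB; apply: (@le_trans _ _ (\sum_(A : {set prime_upto R}) \sum_(B : {set prime_upto R}) `|sieve_coef A| * `|sieve_coef B|)); last first.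
  rewrite -[4%N]/(2 * 2)%N exprM [X in _ <= X]expr2.
  under eq_bigr do rewrite -mulr_sumr.
  rewrite -mulr_suml; apply: ler_pM; rewrite ?sum_sieve_coef_le //; apply: sumr_ge0 => A _; exact: normr_ge0.
apply: le_trans (ler_norm_sum _ _ _) _; apply: ler_sum => A _.
rewrite -sumrB; apply: le_trans (ler_norm_sum _ _ _) _; apply: ler_sum => B _.
rewrite -mulrBr normrM [`|sieve_coef A * sieve_coef B|]normrM.
have [AD|/(sieve_coef_out K prime_val sieve_supp_down) ->] := boolP (A \in sieve_supp); last by rewrite normr0 !mul0r.
have [BD|/(sieve_coef_out K prime_val sieve_supp_down) ->] := boolP (B \in sieve_supp); last by rewrite normr0 mulr0 !mul0r.
rewrite -mulrA ler_wpM2l // ler_piMr //.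
have coM : coprime (subset_prod (A :|: B)) M.
  move: AD BD; rewrite !inE !subset_prod_coprime => /andP[/forall_inP hA _] /andP[/forall_inP hB _].
  by apply/forall_inP => i; rewrite inE => /orP[/hA|/hB].
have coQ : coprime (subset_prod (A :|: B)) Q = [disjoint A & T] && [disjoint B & T].
  rewrite subset_prod_coprime; apply/forall_inP/andP => [h|[dA dB] i].
    rewrite !disjoint_subset; split; apply/subsetP => i iA; rewrite !inE; apply: h; rewrite inE iA ?orbT //.
  by rewrite inE => /orP[iA|iB]; [have := disjointFr dA iA | have := disjointFr dB iB]; rewrite inE => ->.
rewrite -coQ; have [co|nco] := boolP (coprime _ Q).
  rewrite mul1r; apply: count_linear => //; first exact: subset_prod_gt0 (@prime_val_gt1) _.
  by rewrite coprimeMr coM.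
rewrite mul0r subr0 /N big_pred0 ?normr0 // => e; apply/negP => /andP[Qe de].
move/negP: nco; apply; rewrite subset_prod_coprime; apply/forall_inP => i iAB.
apply/negP => iQ; have ie := dvdn_trans iQ Qe.
have : (prime_val i %| M * e + 1)%N by move: de; rewrite subset_prod_dvdE => /forall_inP; apply.
by rewrite dvdn_addr ?dvdn_mull // dvdn1 => /eqP i1; have := prime_val_gt1 i; rewrite i1.
Qed.
End SievePrimes.

(** * Lower bound for the mass of the sieve *)

Lemma sum_inv_sq_le (K : realFieldType) n :
  \sum_(1 <= b < n.+2) (b%:R ^+ 2)^-1 <= 2 - n.+1%:R^-1 :> K.
Proof.
elim: n => [|n IH]; first by rewrite big_nat1 expr1n; lra.
rewrite big_nat_recr //=.
have h : (n.+2%:R ^+ 2)^-1 <= n.+1%:R^-1 - n.+2%:R^-1 :> K.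
  have -> : n.+1%:R^-1 - n.+2%:R^-1 = (n.+1%:R * n.+2%:R)^-1 :> K.
    have -> : n.+2%:R = n.+1%:R + 1 :> K by rewrite -natr1.
    have n1 : 0 < n.+1%:R :> K by rewrite ltr0n.
    field; apply/andP; split; lra.
  by rewrite lef_pV2 ?posrE ?mulr_gt0 ?exprn_gt0 ?ltr0n // expr2 ler_pM2r ?ltr0n // ler_nat.
by apply: le_trans (lerD IH h) _; rewrite addrA subrK.
Qed.

Section Mass.
Variables (K : realFieldType) (R : nat).
Hypothesis R_gt0 : (0 < R)%N.
Local Notation prime_val := (@prime_val R).
Local Notation subset_prod := (subset_prod prime_val).
Implicit Types (A B T : {set prime_upto R}).

Lemma square_decomposition n : (0 < n)%N -> (n <= R)%N ->
  exists A b, n = (subset_prod A * b ^ 2)%N.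
Proof.
have [m] := ubnP n; elim: m n => // m IH n nm n0 nR.
have [/hasP[q _ /andP[pq qn]]|/hasPn nosq] := boolP (has (fun q => prime q && (q ^ 2 %| n)%N) (iota 0 n.+1)).
  case/dvdnP: qn => k nE; have q2 := prime_gt1 pq.
  have k0 : (0 < k)%N by case: k nE n0 => // ->.
  have kn : (k < n)%N by rewrite nE; nia.
  have [A [b kE]] : exists A b, k = (subset_prod A * b ^ 2)%N by apply: IH => //; lia.
  by exists A, (b * q)%N; rewrite nE kE expnMn mulnA.
pose A := [set i : prime_upto R | prime_val i %| n]%N; exists A, 1%N; rewrite exp1n muln1.
have /dvdnP[k nE] : (subset_prod A %| n)%N.
  by rewrite subset_prod_dvdE; apply/forall_inP => i; rewrite inE.
suff k1 : k = 1%N by rewrite nE k1 mul1n.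
apply/eqP; rewrite -[_ == _]negbK; apply/negP => k1.
have k0 : (0 < k)%N by case: k nE n0 {k1} => // ->.
have k2 : (1 < k)%N by lia.
have pq := pdiv_prime k2; set q := pdiv k in pq; have qk : (q %| k)%N := pdiv_dvd k.
have qn : (q %| n)%N by rewrite nE dvdn_mulr.
have [i iq] := prime_uptoP pq (leq_trans (dvdn_leq n0 qn) nR).
have iA : i \in A by rewrite inE iq.
have q2n : (q ^ 2 %| n)%N by rewrite nE -mulnn dvdn_mul // -iq prime_val_dvd.
have qn' : q \in iota 0 n.+1 by rewrite mem_iota /= add0n ltnS; apply: dvdn_leq.
by have := nosq q qn'; rewrite pq q2n.
Qed.

Lemma inv_subset_prod_le A : (subset_prod A)%:R^-1 <= inv_totient K prime_val A.
Proof.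
rewrite /inv_totient /subset_prod natr_prod -prodfV; apply: ler_prod => i _.
have h : 1 < (prime_val i)%:R :> K by rewrite ltr1n prime_val_gt1.
rewrite invr_ge0 ler0n /= lef_pV2 ?posrE; lra.
Qed.

(** Every [n <= R] is a squarefree [n <= R] times a square, the sum of the
    inverse squares is at most 2, and an integer is at least its totient. *)
Lemma harmonic_le_sieve_mass1 :
  \sum_(1 <= n < R.+1) n%:R^-1 <= 2 * sieve_mass K prime_val (sieve_supp R 1).
Proof.
apply: (@le_trans _ _ (\sum_(1 <= n < R.+1) \sum_(A in sieve_supp R 1) \sum_(1 <= b < R.+1)
   (n == subset_prod A * b ^ 2)%N%:R * (n%:R^-1 : K))).
  rewrite big_nat_cond [X in _ <= X]big_nat_cond; apply: ler_sum => n /andP[/andP[n0 nR] _].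
  rewrite ltnS in nR; have [A [b nE]] := square_decomposition n0 nR.
  have b0 : (0 < b)%N by case: b nE n0 => // ->; rewrite muln0.
  have A0 : (0 < subset_prod A)%N by apply: subset_prod_gt0; apply: prime_val_gt1.
  have AR : (subset_prod A <= R)%N by apply: leq_trans nR; rewrite nE leq_pmulr // expn_gt0 b0.
  have bR : (b <= R)%N by apply: leq_trans nR; rewrite nE; nia.
  have p0 B c : 0 <= (n == subset_prod B * c ^ 2)%N%:R * (n%:R^-1 : K).
    by rewrite mulr_ge0 // invr_ge0.
  rewrite (bigD1 A) /=; last by rewrite inE coprimen1.
  rewrite (bigD1_seq b) ?iota_uniq ?mem_index_iota ?b0 //= -nE eqxx mul1r -addrA lerDl.
  by apply: addr_ge0; apply: sumr_ge0 => *; [|apply: sumr_ge0 => *]; apply: p0.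
rewrite exchange_big /= /sieve_mass mulr_sumr; apply: ler_sum => A _.
have A0 : (0 < subset_prod A)%N by apply: subset_prod_gt0; apply: prime_val_gt1.
rewrite exchange_big /=.
apply: (@le_trans _ _ (\sum_(1 <= b < R.+1) inv_totient K prime_val A * (b%:R ^+ 2)^-1)).
  rewrite big_nat_cond [X in _ <= X]big_nat_cond; apply: ler_sum => b /andP[/andP[b0 bR] _].
  apply: (@le_trans _ _ ((subset_prod A * b ^ 2)%N%:R^-1)); last first.
    rewrite natrM natrX invfM ler_pM2r ?invr_gt0 ?exprn_gt0 ?ltr0n //.
    exact: inv_subset_prod_le.
  set m := (subset_prod A * _)%N.
  have [mR|mR] := boolP (m \in index_iota 1 R.+1).
    rewrite (bigD1_seq m) ?iota_uniq //= eqxx mul1r big1 ?addr0 // => n /negPf ->.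
    by rewrite mul0r.
  rewrite big_seq big1 ?invr_ge0 // => n nR; case: eqP => [e|]; rewrite ?mul0r //.
  by rewrite -e nR in mR.
rewrite -mulr_sumr mulrC; have := sum_inv_sq_le K R.-1; rewrite prednK // => h.
rewrite ler_pM2r; last by apply: inv_totient_gt0; apply: prime_val_gt1.
apply: le_trans h _; have : 0 <= R%:R^-1 :> K by rewrite invr_ge0.
lra.
Qed.

(** Splitting a squarefree integer into its parts coprime to [M] and dividing a
    power of [M]. *)
Lemma sieve_mass1_le M : sieve_mass K prime_val (sieve_supp R 1) <=
  sieve_mass K prime_val (sieve_supp R M) * euler_factor K prime_val [set i | prime_val i %| M]%N.
Proof.
set T := [set i | _]; rewrite /sieve_mass (partition_big (fun B => B :\: T) (mem (sieve_supp R M))) /=.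
  rewrite mulr_suml; apply: ler_sum => E; rewrite inE => /andP[co _].
  have dET : [disjoint E & T].
    rewrite disjoint_subset; apply/subsetP => i iE; rewrite !inE.
    by move: co; rewrite subset_prod_coprime => /forall_inP; apply.
  apply: le_trans (sum_inv_totient_fiber_le K (@prime_val_gt1 R) (@sieve_supp_down R 1) dET) _.
  have e0 : 0 <= euler_factor K prime_val T.
    apply: prodr_ge0 => i _; rewrite addr_ge0 // invr_ge0 subr_ge0 ler1n.
    exact/ltnW/prime_val_gt1.
  have t0 : 0 <= inv_totient K prime_val E by apply/ltW/inv_totient_gt0; apply: prime_val_gt1.
  by case: (_ \in _); rewrite ?mul1r // mul0r mulr_ge0.
move=> B; rewrite !inE => /andP[_ BR]; apply/andP; split.
  by rewrite subset_prod_coprime; apply/forall_inP => i; rewrite !inE => /andP[].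
apply: leq_trans BR; apply: dvdn_leq; first by apply: subset_prod_gt0; apply: prime_val_gt1.
exact/subset_prodS/subsetDl.
Qed.

Lemma harmonic_le_sieve_mass M : euler_factor K prime_val [set i | prime_val i %| M]%N <= 2 ->
  \sum_(1 <= n < R.+1) n%:R^-1 <= 4 * sieve_mass K prime_val (sieve_supp R M).
Proof.
move=> e2; apply: le_trans harmonic_le_sieve_mass1 _.
have g0 : 0 < sieve_mass K prime_val (sieve_supp R M) by apply: sieve_mass_gt0; [apply: prime_val_gt1|apply: sieve_supp0].
have := sieve_mass1_le M.
have : sieve_mass K prime_val (sieve_supp R M) * euler_factor K prime_val [set i | prime_val i %| M]%N <= sieve_mass K prime_val (sieve_supp R M) * 2.
  by rewrite ler_pM2l.
lra.
Qed.
End Mass.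

(** * A Turan-Kubilius inequality with sieve weights *)

Section TuranKubilius.
Variables (K : realFieldType) (R y : nat).
Local Notation prime_val := (@prime_val R).

Definition window : {set prime_upto R} := [set i | y < prime_val i]%N.
Definition window_omega (e : nat) : nat := (\sum_(i in window) (prime_val i %| e))%N.
Definition window_mass : K := \sum_(i in window) (prime_val i)%:R^-1.

Variables (M X : nat).
Hypothesis R_gt0 : (0 < R)%N.
Local Notation sieve_supp := (sieve_supp R M).
Local Notation sieve_mass := (sieve_mass K prime_val sieve_supp).
Local Notation sieve_form := (sieve_form K prime_val sieve_supp).
Local Notation w := (sieve_weight R M K).
Local Notation L := window_mass.
Hypothesis y_gt0 : (0 < y)%N.
Hypothesis L_ge1 : 1 <= L.
Hypothesis L_small : 17 * L <= y%:R.

Let t : K := y%:R^-1.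
Let Z : K := X%:R / sieve_mass.
Let E : K := R%:R ^+ 4.
Let S Q := \sum_(0 <= e < X | (Q %| e)%N) w (M * e + 1).

Let G_gt0 : 0 < sieve_mass.
Proof. by apply: sieve_mass_gt0; [apply: prime_val_gt1|apply: sieve_supp0]. Qed.

Let Z_ge0 : 0 <= Z.
Proof. by rewrite divr_ge0 // ltW. Qed.

Let t_gt0 : 0 < t.
Proof. by rewrite invr_gt0 ltr0n. Qed.

Let tL : 17 * t * L <= 1.
Proof.
have y0 : 0 < y%:R :> K by rewrite ltr0n.
by rewrite mulrAC ler_pdivrMr ?mul1r.
Qed.

Let t_le : 17 * t <= 1.
Proof. by apply: le_trans tL; rewrite ler_peMr // mulr_ge0 // ltW. Qed.

Let hq_le i : i \in window -> ((prime_val i)%:R - 1)^-1 <= t.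
Proof.
rewrite inE => yi; have yi' : y%:R + 1 <= (prime_val i)%:R :> K by rewrite natr1 ler_nat.
have y0 : 0 < y%:R :> K by rewrite ltr0n.
by rewrite /t lef_pV2 ?posrE; lra.
Qed.

Let hq_ge0 i : 0 <= ((prime_val i)%:R - 1)^-1 :> K.
Proof. by rewrite invr_ge0 subr_ge0 ler1n; apply/ltnW/prime_val_gt1. Qed.

Let sp0 i : (0 < prime_val i)%N. Proof. exact/ltnW/prime_val_gt1. Qed.
Let spK0 i : 0 < (prime_val i)%:R :> K. Proof. by rewrite ltr0n. Qed.

Let dvd_set i : [set j | (prime_val j %| prime_val i)%N] = [set i].
Proof. by apply/setP => j; rewrite !inE dvdn_prime2 ?prime_val_prime // (inj_eq (@prime_val_inj R)). Qed.

Let dvd_set2 i j : [set k | (prime_val k %| prime_val i * prime_val j)%N] = [set i; j].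
Proof.
apply/setP => k; rewrite !inE Euclid_dvdM ?prime_val_prime //.
by rewrite !dvdn_prime2 ?prime_val_prime // !(inj_eq (@prime_val_inj R)).
Qed.

Let S1_le : S 1 <= Z + E.
Proof.
have := sieve_weight_sum M R_gt0 K X (isT : 0 < 1)%N; rewrite -/(S 1) ler_distl => /andP[_].
move/le_trans; apply; rewrite lerD2r divr1 /Z ler_wpM2l //.
apply: le_trans (sieve_form_le K (@prime_val_gt1 R) (sieve_supp0 M R_gt0) (@sieve_supp_down R M) _) _.
rewrite /euler_factor big_pred0 ?expr1n ?mul1r // => i; rewrite inE dvdn1.
by apply/negbTE; rewrite neq_ltn prime_val_gt1 orbT.
Qed.

Let Sq_le i : i \in window -> S (prime_val i) <= (prime_val i)%:R^-1 * Z * (1 + t) ^+ 2 + E.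
Proof.
move=> iW; have := sieve_weight_sum M R_gt0 K X (sp0 i).
rewrite -/(S (prime_val i)) ler_distl => /andP[_]; move/le_trans; apply; rewrite lerD2r dvd_set.
have -> : (prime_val i)%:R^-1 * Z * (1 + t) ^+ 2 = X%:R / (prime_val i)%:R * ((1 + t) ^+ 2 / sieve_mass).
  by rewrite /Z; ring.
rewrite ler_wpM2l ?divr_ge0 //.
apply: le_trans (sieve_form_le K (@prime_val_gt1 R) (sieve_supp0 M R_gt0) (@sieve_supp_down R M) _) _.
rewrite ler_pM2r ?invr_gt0 // /euler_factor big_set1 lerXn2r ?nnegrE ?addr_ge0 ?(ltW t_gt0) //.
by rewrite lerD2l hq_le.
Qed.

Let Sq_ge i : i \in window -> (prime_val i)%:R^-1 * Z * (1 - t) - E <= S (prime_val i).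
Proof.
move=> iW; have := sieve_weight_sum M R_gt0 K X (sp0 i).
rewrite -/(S (prime_val i)) ler_distl => /andP[+ _]; apply: le_trans; rewrite lerD2r dvd_set.
have -> : (prime_val i)%:R^-1 * Z * (1 - t) = X%:R / (prime_val i)%:R * ((1 - t) / sieve_mass).
  by rewrite /Z; ring.
rewrite ler_wpM2l ?divr_ge0 //.
apply: le_trans (sieve_form1_ge K (@prime_val_gt1 R) (sieve_supp0 M R_gt0) (@sieve_supp_down R M) _).
by rewrite ler_pM2r ?invr_gt0 // lerD2l lerN2 hq_le.
Qed.

Let Sqq_le i j : i \in window -> j \in window -> i != j ->
  S (prime_val i * prime_val j) <= (prime_val i)%:R^-1 * (prime_val j)%:R^-1 * Z * (1 + t) ^+ 4 + E.
Proof.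
move=> iW jW ij; have := sieve_weight_sum M R_gt0 K X (_ : 0 < prime_val i * prime_val j)%N; rewrite muln_gt0 !sp0 => /(_ isT).
rewrite -/(S (prime_val i * prime_val j)) ler_distl => /andP[_]; move/le_trans; apply; rewrite lerD2r dvd_set2.
have -> : (prime_val i)%:R^-1 * (prime_val j)%:R^-1 * Z * (1 + t) ^+ 4 =
    X%:R / (prime_val i * prime_val j)%:R * (((1 + t) * (1 + t)) ^+ 2 / sieve_mass).
  by rewrite /Z natrM invfM; ring.
rewrite ler_wpM2l ?divr_ge0 //.
apply: le_trans (sieve_form_le K (@prime_val_gt1 R) (sieve_supp0 M R_gt0) (@sieve_supp_down R M) _) _.
rewrite ler_pM2r ?invr_gt0 // /euler_factor big_setU1 ?inE //= big_set1.
have a k : 0 <= 1 + ((prime_val k)%:R - 1)^-1 :> K by rewrite addr_ge0.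
have t1 : 0 <= 1 + t by rewrite addr_ge0 // ltW.
by rewrite lerXn2r ?nnegrE ?mulr_ge0 // ler_pM // lerD2l hq_le.
Qed.

Let n_le : #|window|%:R <= R%:R :> K.
Proof.
rewrite ler_nat; have -> : #|window| = size [seq prime_val i | i <- enum window].
  by rewrite size_map -cardE.
rewrite -[R in (_ <= R)%N](size_iota 1).
apply: uniq_leq_size; first by rewrite map_inj_uniq ?enum_uniq //; apply: prime_val_inj.
move=> n /mapP[i _ ->]; rewrite mem_iota sp0 add1n.
exact: ltn_ord (val i).
Qed.

Let L_le : L <= #|window|%:R.
Proof.
rewrite -sum1_card natr_sum; apply: ler_sum => i _.
by rewrite invf_le1 // ler1n.
Qed.

(** The Brun-Titchmarsh inequality. *)
Lemma prime_count_le :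
  (\sum_(0 <= e < X | prime (M * e + 1) && (R < M * e + 1)%N) 1)%N%:R <= X%:R / sieve_mass + R%:R ^+ 4.
Proof.
apply: le_trans S1_le; rewrite /S natr_sum big_mkcond [X in _ <= X]big_mkcond.
apply: ler_sum => e _; rewrite dvd1n; case: ifP => [/andP[pe Re]|_]; last exact: sqr_ge0.
by rewrite sieve_weight_prime.
Qed.

Lemma variance_expand e :
  ((window_omega e)%:R - L) ^+ 2 =
  \sum_(i in window) \sum_(j in window | j != i) (prime_val i * prime_val j %| e)%N%:R
  + (1 - 2 * L) * \sum_(i in window) (prime_val i %| e)%N%:R + L ^+ 2 :> K.
Proof.
rewrite /window_omega natr_sum; set s := \sum_(i in window) (prime_val i %| e)%N%:R.
have : s ^+ 2 = \sum_(i in window) \sum_(j in window | j != i) (prime_val i * prime_val j %| e)%N%:R + s.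
  rewrite expr2 {1}/s mulr_suml -[X in _ + X]/s /s -big_split; apply: eq_bigr => i iW /=.
  rewrite mulr_sumr (bigD1 i) //= addrC; congr (_ + _).
    apply: eq_bigr => j /andP[_ ji]; rewrite Gauss_dvd; last first.
      by rewrite prime_coprime ?prime_val_prime // dvdn_prime2 ?prime_val_prime // (inj_eq (@prime_val_inj R)) eq_sym.
    by rewrite -natrM mulnb.
  by rewrite -natrM mulnb andbb.
move=> e2; rewrite sqrrB e2; ring.
Qed.

(** The three main terms, of size [L ^ 2], [- 2 * L ^ 2] and [L ^ 2] times [Z],
    cancel up to a relative error [O(1 / y)], which [17 * L <= y] absorbs; the
    diagonal leaves [L * Z].  The last term collects the errors of
    [sieve_weight_sum] over at most [R ^ 2] pairs of primes. *)
Lemma variance_le :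
  \sum_(0 <= e < X) w (M * e + 1) * ((window_omega e)%:R - L) ^+ 2 <=
  3 * L * Z + 9 * R%:R ^+ 6.
Proof.
have SE Q : \sum_(0 <= e < X) w (M * e + 1) * (Q %| e)%N%:R = S Q.
  by rewrite /S [RHS]big_mkcond; apply: eq_bigr => e _; case: ifP; rewrite ?mulr1 ?mulr0.
have -> : \sum_(0 <= e < X) w (M * e + 1) * ((window_omega e)%:R - L) ^+ 2 =
   \sum_(i in window) \sum_(j in window | j != i) S (prime_val i * prime_val j)
   + (1 - 2 * L) * \sum_(i in window) S (prime_val i) + L ^+ 2 * S 1.
  under eq_bigr do rewrite variance_expand !mulrDr.
  rewrite !big_split /=; congr (_ + _ + _).
  - under eq_bigr do rewrite mulr_sumr.
    rewrite exchange_big; apply: eq_bigr => i _ /=.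
    under eq_bigr do rewrite mulr_sumr.
    by rewrite exchange_big; apply: eq_bigr => j _ /=; rewrite SE.
  - under eq_bigr do rewrite mulrCA.
    rewrite -[LHS]mulr_sumr; congr (_ * _).
    under [LHS]eq_bigr => e _ do rewrite mulr_sumr.
    by rewrite exchange_big; apply: eq_bigr => i _ /=; rewrite SE.
  - rewrite -mulr_suml mulrC; congr (_ * _); rewrite -SE.
    by apply: eq_bigr => e _; rewrite dvd1n mulr1.
set n : K := #|window|%:R.
have E0 : 0 <= E by rewrite exprn_ge0.
have n0 : 0 <= n by [].
have a1 : \sum_(i in window) \sum_(j in window | j != i) S (prime_val i * prime_val j) <=
          Z * (1 + t) ^+ 4 * L ^+ 2 + n ^+ 2 * E.
  apply: (@le_trans _ _ (\sum_(i in window) \sum_(j in window)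
     ((prime_val i)%:R^-1 * (prime_val j)%:R^-1 * Z * (1 + t) ^+ 4 + E))).
    apply: ler_sum => i iW; rewrite big_mkcondr; apply: ler_sum => j jW.
    case: ifP => ji; first by apply: Sqq_le; rewrite // eq_sym.
    have u0 : 0 <= 1 + t by rewrite addr_ge0 // ltW.
    by rewrite addr_ge0 // mulr_ge0 ?exprn_ge0 // mulr_ge0 // mulr_ge0 ?invr_ge0 //.
  under eq_bigr do rewrite big_split /= sumr_const -2!mulr_suml -mulr_sumr -/L.
  rewrite big_split /= sumr_const -!mulr_suml -/L -mulrnA -[E *+ _]mulr_natr natrM -/n.
  by rewrite le_eqVlt; apply/orP; left; apply/eqP; ring.
have a2 : \sum_(i in window) S (prime_val i) <= Z * (1 + t) ^+ 2 * L + n * E.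
  apply: (@le_trans _ _ (\sum_(i in window) ((prime_val i)%:R^-1 * Z * (1 + t) ^+ 2 + E))).
    by apply: ler_sum => i; apply: Sq_le.
  rewrite big_split /= sumr_const -!mulr_suml -/L -[E *+ _]mulr_natr -/n.
  by rewrite le_eqVlt; apply/orP; left; apply/eqP; ring.
have a3 : Z * (1 - t) * L - n * E <= \sum_(i in window) S (prime_val i).
  apply: (@le_trans _ _ (\sum_(i in window) ((prime_val i)%:R^-1 * Z * (1 - t) - E))); last first.
    by apply: ler_sum => i; apply: Sq_ge.
  rewrite sumrB /= sumr_const -!mulr_suml -/L -[E *+ _]mulr_natr -/n.
  by rewrite le_eqVlt; apply/orP; left; apply/eqP; ring.
have a4 := S1_le.
set A := \sum_(i in window) \sum_(j in _ | _) _ in a1 *; set B := \sum_(i in window) S _ in a2 a3 *.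
have L0 : 0 <= L by apply: le_trans L_ge1.
have h1 : L * (Z * (1 - t) * L - n * E) <= L * B by apply: ler_wpM2l.
have h2 : L ^+ 2 * S 1 <= L ^+ 2 * (Z + E) by apply: ler_wpM2l => //; apply: exprn_ge0.
have t0 := t_gt0; have t1 := t_le.
(* [15 * t] and the [2 * t] of [h1] add up to [17 * t] in [tL] *)
have p4 : (1 + t) ^+ 4 <= 1 + 15 * t by nra.
have p2 : (1 + t) ^+ 2 <= 2 by nra.
have ZL2 : 0 <= Z * L ^+ 2 by rewrite mulr_ge0 ?exprn_ge0.
have ZL : 0 <= Z * L by rewrite mulr_ge0.
have k1 : Z * (1 + t) ^+ 4 * L ^+ 2 <= Z * L ^+ 2 * (1 + 15 * t).
  by rewrite mulrAC ler_wpM2l.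
have k2 : Z * (1 + t) ^+ 2 * L <= Z * L * 2 by rewrite mulrAC ler_wpM2l.
have k3 : Z * L * (17 * t * L) <= Z * L * 1 by apply: ler_wpM2l.
have nR : n <= R%:R := n_le; have Ln : L <= n := L_le.
have R1 : 1 <= R%:R :> K by rewrite ler1n.
have k4 : E * (n ^+ 2 + n + 2 * L * n + L ^+ 2) <= E * (9 * R%:R ^+ 2).
  apply: ler_wpM2l => //; nra.
have k5 : E * (9 * R%:R ^+ 2) = 9 * R%:R ^+ 6 :> K by rewrite /E; ring.
rewrite -k5; lra.
Qed.

(** Chebyshev's inequality. *)
Lemma atypical_count_le :
  (\sum_(0 <= e < X | [&& prime (M * e + 1), (R < M * e + 1)%N &
      (L / 4 <= `|(window_omega e)%:R - L|)%R]) 1)%N%:R <=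
  48 * X%:R / (L * sieve_mass) + 144 * R%:R ^+ 6 / L ^+ 2.
Proof.
have L0 : 0 < L by apply: lt_le_trans L_ge1.
have h : (\sum_(0 <= e < X | [&& prime (M * e + 1), (R < M * e + 1)%N &
      (L / 4 <= `|(window_omega e)%:R - L|)%R]) 1)%N%:R * (L / 4) ^+ 2 <=
   \sum_(0 <= e < X) w (M * e + 1) * ((window_omega e)%:R - L) ^+ 2.
  rewrite natr_sum mulr_suml big_mkcond; apply: ler_sum => e _.
  case: ifP => [/and3P[pe Re te]|_]; last by rewrite mulr_ge0 ?sqr_ge0.
  rewrite sieve_weight_prime // !mul1r -[X in _ <= X]real_normK ?num_real //.
  by rewrite lerXn2r ?nnegrE ?divr_ge0 // ltW.
have := le_trans h variance_le; rewrite -ler_pdivlMr ?exprn_gt0 ?divr_gt0 //.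
move/le_trans; apply; rewrite le_eqVlt; apply/orP; left; apply/eqP.
rewrite /Z; field; by rewrite !gt_eqF.
Qed.
End TuranKubilius.

(** * Logarithms, harmonic sums and reciprocals of primes *)

Section Logs.
Variable F : realType.
Implicit Types (n k q y A B : nat).

Lemma ln_nat_ge0 n : 0 <= ln (n%:R : F).
Proof.
case: n => [|n]; first by rewrite ln0.
by apply: ln_ge0; rewrite ler1n.
Qed.

Lemma ln_nat_le m n : (0 < m)%N -> (m <= n)%N -> ln (m%:R : F) <= ln n%:R.
Proof.
by move=> m0 mn; rewrite ler_ln ?posrE ?ltr0n ?ler_nat // (leq_trans m0).
Qed.

Lemma ln_natX n k : (0 < n)%N -> ln ((n ^ k)%N%:R : F) = k%:R * ln n%:R.
Proof. by move=> n0; rewrite natrX lnXn ?ltr0n // mulr_natl. Qed.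

Lemma ln_natM m n : (0 < m)%N -> (0 < n)%N -> ln ((m * n)%N%:R : F) = ln m%:R + ln n%:R.
Proof. by move=> m0 n0; rewrite natrM lnM ?posrE ?ltr0n. Qed.

Lemma ln_succ_le n : (0 < n)%N -> ln (n.+1%:R : F) - ln n%:R <= n%:R^-1.
Proof.
move=> n0; rewrite -ln_div ?posrE ?ltr0n //.
have nK : 0 < n%:R :> F by rewrite ltr0n.
have -> : n.+1%:R / n%:R = 1 + n%:R^-1 :> F by rewrite -natr1 mulrDl mul1r divff ?gt_eqF.
by apply: le_ln1Dx; rewrite (@lt_trans _ _ 0) ?ltrN10 ?invr_gt0.
Qed.

Lemma ln_succ_ge n : (0 < n)%N -> n.+1%:R^-1 <= ln (n.+1%:R : F) - ln n%:R.
Proof.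
move=> n0; have nK : 0 < n%:R :> F by rewrite ltr0n.
have n1K : 0 < n.+1%:R :> F by rewrite ltr0n.
have : ln (1 + - n.+1%:R^-1) <= - n.+1%:R^-1 :> F.
  by apply: le_ln1Dx; rewrite ltrN2 invf_lt1 // ltr1n ltnS.
have -> : 1 - n.+1%:R^-1 = n%:R / n.+1%:R :> F.
  have e : n.+1%:R = n%:R + 1 :> F by rewrite natr1.
  by rewrite e; field; rewrite -e gt_eqF.
by rewrite ln_div ?posrE // lerNr opprB.
Qed.

Lemma ln_succ_le_harmonic n : ln (n.+1%:R : F) <= \sum_(1 <= k < n.+1) k%:R^-1.
Proof.
elim: n => [|n IH]; first by rewrite big_geq // ln1.
rewrite big_nat_recr //=; have := @ln_succ_le n.+1 isT; rewrite lerBlDr => h.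
by apply: le_trans h _; rewrite [X in X <= _]addrC lerD2r.
Qed.

Lemma ln_le_harmonic n : ln (n%:R : F) <= \sum_(1 <= k < n.+1) k%:R^-1.
Proof.
case: n => [|n]; first by rewrite ln0 // big_geq.
by apply: le_trans (ln_succ_le_harmonic _); apply: ln_nat_le.
Qed.

Lemma harmonic_interval_le A B : (0 < A)%N -> (A <= B)%N ->
  \sum_(A <= k < B.+1) k%:R^-1 <= 1 + ln (B%:R : F) - ln A%:R.
Proof.
move=> A0 /subnK <-; elim: (B - A)%N => [|n IH].
  by rewrite add0n big_nat1 addrK invf_le1 ?ltr0n // ler1n.
rewrite big_nat_recr /=; last by rewrite addSn; lia.
have nA : (0 < n + A)%N by rewrite addn_gt0 A0 orbT.
have := ln_succ_ge nA; rewrite addSn => h.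
by apply: le_trans (lerD IH h) _; rewrite le_eqVlt; apply/orP; left; apply/eqP; ring.
Qed.

Lemma ln_factor n N : (0 < n)%N -> (n <= N)%N ->
  ln (n%:R : F) = \sum_(0 <= q < N.+1 | prime q) (logn q n)%:R * ln q%:R.
Proof.
move=> n0 nN; rewrite -[n in LHS]partnT // (widen_partn _ nN).
rewrite (_ : (\prod_(0 <= p < _ | _) _ = \prod_(0 <= p < N.+1) p ^ logn p n)%N); last first.
  exact: eq_bigl.
have gt0 (q : nat) : (0 < q ^ logn q n)%N by case: q => // ; rewrite lognE.
rewrite (_ : ln _ = \sum_(0 <= q < N.+1) ln ((q ^ logn q n)%N%:R : F)); last first.
  elim: N.+1 => [|m IH]; first by rewrite !big_geq // ln1.
  rewrite !big_nat_recr //= -IH ln_natM //.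
  by apply: prodn_gt0.
rewrite [RHS]big_mkcond; apply: eq_bigr => q _; case: ifP => [pq|npq].
  by rewrite ln_natX // prime_gt0.
by rewrite lognE npq ln1.
Qed.

Lemma ln_factorial n :
  \sum_(1 <= k < n.+1) ln (k%:R : F) =
  \sum_(0 <= q < n.+1 | prime q) (\sum_(1 <= k < n.+1) n %/ q ^ k)%N%:R * ln q%:R.
Proof.
transitivity (\sum_(1 <= k < n.+1) \sum_(0 <= q < n.+1 | prime q) (logn q k)%:R * ln (q%:R : F)).
  by rewrite !big_nat; apply: eq_bigr => k /andP[k0 kn]; rewrite (@ln_factor k n).
rewrite exchange_big /=; apply: eq_bigr => q pq; rewrite -mulr_suml -natr_sum.
congr (_%:R * _); rewrite -logn_fact //.
elim: n => [|m IH]; first by rewrite big_geq // logn1.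
by rewrite big_nat_recr //= IH factS lognM ?fact_gt0 // addnC.
Qed.

Lemma geom_le q m : (1 < q)%N ->
  \sum_(1 <= k < m) (q ^ k)%N%:R^-1 <= (q%:R - 1)^-1 :> F.
Proof.
move=> q1; have qK : 1 < q%:R :> F by rewrite ltr1n.
have q0 : 0 < q%:R :> F by apply: lt_trans qK.
have h k : \sum_(1 <= k < k.+1) (q ^ k)%N%:R^-1 = (1 - (q%:R ^+ k)^-1) / (q%:R - 1) :> F.
  elim: k => [|k IH]; first by rewrite big_geq // expr0 invr1 subrr mul0r.
  rewrite big_nat_recr //= IH natrX exprS; field.
  by rewrite expf_neq0 ?gt_eqF // subr_gt0.
case: m => [|m]; first by rewrite big_geq // invr_ge0 subr_ge0 ltW.
rewrite h ler_pdivrMr ?subr_gt0 // mulVf ?gt_eqF ?subr_gt0 // gerBl invr_ge0 exprn_ge0 //.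
Qed.

(** The factorization of [n!] gives [n * ln n >= \sum (n %/ q) * ln q], and
    [n %/ q >= n / (2 * q)] for [q <= n]. *)
Lemma sum_ln_prime_div_le n :
  \sum_(0 <= q < n.+1 | prime q) ln (q%:R : F) / q%:R <= 2 * ln n%:R.
Proof.
have [->|n0] := posnP n.
  by rewrite big_mkcond big_nat1 /= ln0 // mulr0.
have nK : 0 < n%:R :> F by rewrite ltr0n.
rewrite -(ler_pM2l nK) mulr_sumr.
apply: (@le_trans _ _ (2 * \sum_(1 <= k < n.+1) ln (k%:R : F))); last first.
  rewrite mulrCA ler_pM2l //; apply: (@le_trans _ _ (\sum_(1 <= k < n.+1) ln (n%:R : F))).
    by apply: ler_sum_nat => k /andP[k0 kn]; apply: ln_nat_le.
  by rewrite sumr_const_nat subn1 /= -[X in X <= _]mulr_natl.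
rewrite ln_factorial mulr_sumr big_nat_cond [X in _ <= X]big_nat_cond.
apply: ler_sum => q /andP[/andP[_ qn] pq]; rewrite ltnS in qn.
have q0 := prime_gt0 pq; have qK : 0 < q%:R :> F by rewrite ltr0n.
rewrite [X in X <= _]mulrA [X in X <= _]mulrAC [X in _ <= X]mulrA.
rewrite ler_wpM2r ?ln_nat_ge0 //.
rewrite ler_pdivrMr // -!natrM ler_nat.
apply: (@leq_trans (2 * (n %/ q) * q)%N); last first.
  by rewrite leq_mul2r leq_mul2l big_ltn // expn1 leq_addr !orbT.
have := divn_eq n q; have := ltn_pmod n q0; have : (0 < n %/ q)%N by rewrite divn_gt0.
nia.
Qed.

Lemma sum_ln_ge n : n%:R * ln n%:R - n%:R <= \sum_(1 <= k < n.+1) ln (k%:R : F).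
Proof.
elim: n => [|n IH]; first by rewrite big_geq // mul0r subr0.
rewrite big_nat_recr //=; apply: le_trans (lerD IH (lexx _)).
have [->|n0] := posnP n; first by rewrite !mulr1n ln1 mulr0n mul0r; lra.
have nK : 0 < n%:R :> F by rewrite ltr0n.
have := ln_succ_le n0; rewrite -(ler_pM2l nK) divff ?gt_eqF // -natr1.
set a := ln _; set b := ln _; lra.
Qed.

(** From the factorization of [n!], bounded below by [n * ln n - n]. *)
Lemma sum_ln_prime_pred_ge n : (0 < n)%N ->
  ln (n%:R : F) - 1 <= \sum_(0 <= q < n.+1 | prime q) ln (q%:R : F) / (q%:R - 1).
Proof.
move=> n0; have nK : 0 < n%:R :> F by rewrite ltr0n.
rewrite -(ler_pM2l nK) mulrBr mulr1; apply: le_trans (sum_ln_ge n) _.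
rewrite ln_factorial mulr_sumr; apply: ler_sum => q pq.
rewrite mulrA mulrAC; apply: ler_wpM2r; first exact: ln_nat_ge0.
apply: le_trans (_ : n%:R * \sum_(1 <= k < n.+1) (q ^ k)%N%:R^-1 <= _); last first.
  by apply: ler_wpM2l; rewrite // geom_le // prime_gt1.
rewrite natr_sum mulr_sumr; apply: ler_sum => k _.
have qk : 0 < (q ^ k)%N%:R :> F by rewrite ltr0n expn_gt0 prime_gt0.
by rewrite ler_pdivlMr // -natrM ler_nat leq_divM.
Qed.

Lemma prime_pred_le2 q (c : F) : prime q -> 0 <= c -> c / (q%:R - 1) <= 2 * (c / q%:R).
Proof.
move=> pq c0; have q2 : 2 <= q%:R :> F by rewrite ler_nat prime_gt1.
rewrite mulrCA ler_wpM2l // -[(q%:R - 1)^-1]div1r ler_pdivrMr; last by lra.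
rewrite mulrAC ler_pdivlMr; lra.
Qed.

(** The exponent 8 is large enough for the lower bound [8 * ln z - 1] at [z ^ 8] to
    beat the upper bound [4 * ln z] at [z]. *)
Lemma window_step z : (4 <= z)%N ->
  3 / 16 <= \sum_(z.+1 <= q < (z ^ 8).+1 | prime q) (q%:R : F)^-1.
Proof.
move=> z4; have zz : (z <= z ^ 8)%N by rewrite -[X in (X <= _)%N]expn1 leq_exp2l //; lia.
have z0 : (0 < z)%N by lia.
have z80 : (0 < z ^ 8)%N by rewrite expn_gt0 z0.
have lz1 : 1 <= ln (z%:R : F).
  apply: (@le_trans _ _ (ln (2 ^ 2)%N%:R)); last exact: ln_nat_le.
  by rewrite ln_natX //; have := @ln_succ_ge 1 isT; rewrite ln1 subr0; lra.
have low := sum_ln_prime_pred_ge z80; rewrite ln_natX // in low.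
have up : \sum_(0 <= q < z.+1 | prime q) ln (q%:R : F) / (q%:R - 1) <= 4 * ln z%:R.
  apply: (@le_trans _ _ (2 * \sum_(0 <= q < z.+1 | prime q) ln (q%:R : F) / q%:R)).
    by rewrite mulr_sumr; apply: ler_sum => q pq; apply: prime_pred_le2; rewrite ?ln_nat_ge0.
  have := sum_ln_prime_div_le z; lra.
rewrite (@big_cat_nat _ _ _ z.+1) //= in low.
have : \sum_(z.+1 <= q < (z ^ 8).+1 | prime q) ln (q%:R : F) / (q%:R - 1) <=
   16 * ln z%:R * \sum_(z.+1 <= q < (z ^ 8).+1 | prime q) (q%:R : F)^-1.
  rewrite mulr_sumr big_nat_cond [X in _ <= X]big_nat_cond.
  apply: ler_sum => q /andP[/andP[zq qz] pq].
  apply: le_trans (prime_pred_le2 pq (ln_nat_ge0 q)) _.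
  rewrite mulrA; apply: ler_wpM2r; first by rewrite invr_ge0.
  have := @ln_nat_le q (z ^ 8) (prime_gt0 pq); rewrite -ltnS => /(_ qz); rewrite ln_natX //; lra.
move: low up; set a := \sum_(0 <= q < z.+1 | _) _; set b := \sum_(_ <= q < _ | _) (_ / _).
set c := \sum_(_ <= q < _ | _) _; set l := ln _ in lz1 *.
move=> low up bc; nra.
Qed.

Lemma window_mass_ge z J : (4 <= z)%N ->
  J%:R * (3 / 16) <= \sum_(z.+1 <= q < (z ^ (8 ^ J)).+1 | prime q) (q%:R : F)^-1.
Proof.
move=> z4; elim: J => [|J IH]; first by rewrite mul0r; apply: sumr_ge0.
have zJ : (z <= z ^ 8 ^ J)%N by rewrite -[X in (X <= _)%N]expn1 leq_exp2l ?expn_gt0 //; lia.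
have zJ' : (z ^ 8 ^ J <= z ^ 8 ^ J.+1)%N by rewrite leq_exp2l ?leq_exp2l //; lia.
rewrite (@big_cat_nat _ _ _ (z ^ 8 ^ J).+1) //=.
have := window_step (leq_trans z4 zJ).
have -> : ((z ^ 8 ^ J) ^ 8 = z ^ 8 ^ J.+1)%N by rewrite -expnM expnSr.
move=> h; apply: le_trans (lerD IH h); rewrite -natr1; lra.
Qed.

(** Multiplied by the sum of [1 / k] for [k <= y], the left sum becomes part of a
    harmonic sum, since the decomposition of [n] into a part free of primes up to
    [y] and a part made of such primes is unique. *)
Lemma rough_sum_le y A B : (1 < y)%N -> (0 < A)%N -> (A <= B)%N ->
  (\sum_(A <= m < B.+1 | [pred q | (y < q)%N].-nat m) (m%:R : F)^-1) * ln y%:R <=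
  1 + ln (B%:R : F) - ln A%:R + ln y%:R.
Proof.
move=> y1 A0 AB; set pi := [pred q | (y < q)%N].
have y0 : (0 < y)%N by lia.
have B0 : (0 < B)%N by apply: leq_trans AB.
have AB' : (A <= B * y)%N by apply: leq_trans AB _; rewrite leq_pmulr.
apply: (@le_trans _ _ (\sum_(A <= n < (B * y).+1) (n%:R : F)^-1)); last first.
  apply: le_trans (harmonic_interval_le A0 AB') _.
  by rewrite ln_natM //; lra.
apply: (@le_trans _ _ ((\sum_(A <= m < B.+1 | pi.-nat m) (m%:R : F)^-1) * \sum_(1 <= k < y.+1) k%:R^-1)).
  by apply: ler_wpM2l; [apply: sumr_ge0|exact: ln_le_harmonic].
rewrite mulr_suml.
apply: (@le_trans _ _ (\sum_(A <= n < (B * y).+1) \sum_(A <= m < B.+1 | pi.-nat m)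
   \sum_(1 <= k < y.+1) (n == m * k)%N%:R * (n%:R : F)^-1)).
  rewrite exchange_big /= big_nat_cond [X in _ <= X]big_nat_cond.
  apply: ler_sum => m /andP[/andP[Am mB] pm]; rewrite exchange_big /= mulr_sumr.
  apply: ler_sum_nat => k /andP[k1 ky]; rewrite -invfM -natrM.
  have mk : (m * k)%N \in index_iota A (B * y).+1.
    by rewrite mem_index_iota (leq_trans Am) ?leq_pmulr //= ltnS leq_mul.
  rewrite (bigD1_seq (m * k)%N) ?iota_uniq //= eqxx mul1r lerDl.
  by apply: sumr_ge0 => *; rewrite mulr_ge0 // invr_ge0.
rewrite big_nat_cond [X in _ <= X]big_nat_cond; apply: ler_sum => n /andP[/andP[An _] _].
have n0 : (0 < n)%N by apply: leq_trans An.
under eq_bigr do rewrite -mulr_suml.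
rewrite -mulr_suml ler_piMl ?invr_ge0 //.
have -> : \sum_(A <= m < B.+1 | pi.-nat m) \sum_(1 <= k < y.+1) (n == m * k)%N%:R =
   \sum_(A <= m < B.+1 | pi.-nat m) \sum_(1 <= k < y.+1) ((m == n`_pi)%N && (k == n`_pi^')%N)%N%:R * (n == m * k)%N%:R :> F.
  rewrite big_nat_cond [RHS]big_nat_cond; apply: eq_bigr => m /andP[/andP[Am _] pm].
  rewrite big_nat_cond [RHS]big_nat_cond; apply: eq_bigr => k /andP[/andP[k1 ky] _].
  case: eqP => [nE|_]; last by rewrite mulr0.
  have m0 : (0 < m)%N by apply: leq_trans Am.
  have pk : pi^'.-nat k.
    rewrite /pnat k1; apply/allP => q; rewrite mem_primes => /and3P[_ _ qk].
    by rewrite !inE -leqNgt; apply: leq_trans (dvdn_leq k1 qk) _.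
  rewrite nE !partnM // (part_pnat_id pm) (part_pnat_id pk).
  rewrite (@part_p'nat pi k) // (@part_p'nat pi^' m) ?pnatNK //.
  by rewrite muln1 mul1n !eqxx mulr1.
set a := (n`_pi)%N; set b := (n`_pi^')%N.
apply: (@le_trans _ _ (\sum_(A <= m < B.+1 | pi.-nat m) (m == a)%:R)).
  apply: ler_sum => m _; case: eqP => ma /=; last by rewrite big1 // => *; rewrite mul0r.
  apply: (@le_trans _ _ (\sum_(1 <= k < y.+1) (k == b)%:R)).
    by apply: ler_sum => k _; rewrite ler_piMr // lern1 leq_b1.
  rewrite -natr_sum ler_nat -big_mkcond /= sum1_count.
  by rewrite count_uniq_mem ?iota_uniq // leq_b1.
rewrite -natr_sum lern1 big_mkcond /=.
apply: (@leq_trans (\sum_(A <= m < B.+1) (m == a))); first by apply: leq_sum => m _; case: ifP.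
rewrite -big_mkcond /= sum1_count.
by rewrite count_uniq_mem ?iota_uniq // leq_b1.
Qed.

End Logs.

(** * The orders of the five products *)

Lemma gcd_lcm_seq n c (s : seq nat) :
  all (fun m => gcdn n m %| c)%N s -> (gcdn n (foldr lcmn 1 s) %| c ^ size s)%N.
Proof.
elim: s => [|m s IH] /=; first by rewrite gcdn1 expn0.
case/andP => cm /IH cs; rewrite expnS; apply: dvdn_trans (dvdn_mul cm cs).
set L := foldr _ _ _.
have h : (gcdn n (lcmn m L) %| gcdn n (m * L))%N.
  by rewrite dvdn_gcd dvdn_gcdl (dvdn_trans (dvdn_gcdr _ _)) // dvdn_lcm dvdn_mulr // dvdn_mull.
apply: dvdn_trans h _.
have a1 := dvdn_gcdl n (m * L); have a2 := dvdn_gcdr n (m * L).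
rewrite muln_gcdl !muln_gcdr !dvdn_gcd a2.
by rewrite (dvdn_mulr n a1) (dvdn_mulr L a1) (dvdn_mull m a1).
Qed.

Lemma prod_dvd_lcm c (s : seq nat) :
  pairwise (fun m n => gcdn m n %| c)%N s ->
  (\prod_(m <- s) m %| c ^ 'C(size s, 2) * foldr lcmn 1 s)%N.
Proof.
elim: s => [|n s IH] /=; first by rewrite big_nil.
case/andP => /gcd_lcm_seq cn /IH cs; rewrite big_cons binS bin1 expnD -mulnA.
set L := foldr _ _ _ in cn cs *.
apply: dvdn_trans (dvdn_mul (dvdnn n) cs) _.
have -> : (n * (c ^ 'C(size s, 2) * L) = c ^ 'C(size s, 2) * (lcmn n L * gcdn n L))%N.
  by rewrite muln_lcm_gcd mulnCA.
by rewrite dvdn_mul // mulnC dvdn_mul.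
Qed.

(** The exponent vectors of the two elements have determinant [+-1], [+-2] or
    [+-3]. *)
Lemma six_power_pair (K : fieldType) (X Y : K) (i j : nat) : X != 0 -> Y != 0 ->
  (i < j < 5)%N ->
  let s := [:: X; Y; X * Y; X ^+ 2 * Y; X * Y ^+ 2] in
  s`_i = 1 -> s`_j = 1 -> X ^+ 6 = 1 /\ Y ^+ 6 = 1.
Proof.
move=> X0 Y0 ij s.
have [sX sY] : (X ^+ 2 = 1 \/ X ^+ 3 = 1 -> X ^+ 6 = 1) /\ (Y ^+ 2 = 1 \/ Y ^+ 3 = 1 -> Y ^+ 6 = 1).
  split; (case=> h; [rewrite -[6%N]/(2 * 3)%N|rewrite -[6%N]/(3 * 2)%N]; by rewrite exprM h expr1n).
case: i ij => [|[|[|[|[|i]]]]]; case: j => [|[|[|[|[|j]]]]] //= _ e1 e2.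
- by rewrite e1 e2 !expr1n.
- by move: e2; rewrite e1 mul1r => ->; rewrite !expr1n.
- by move: e2; rewrite e1 expr1n mul1r => ->; rewrite !expr1n.
- by move: e2; rewrite e1 mul1r expr1n => e2; split=> //; apply: sY; left.
- by move: e2; rewrite e1 mulr1 => ->; rewrite !expr1n.
- by move: e2; rewrite e1 mulr1 expr1n => e2; split=> //; apply: sX; left.
- by move: e2; rewrite e1 expr1n mulr1 => ->; rewrite !expr1n.
- have X1 : X = 1 by move: e2; rewrite expr2 -mulrA e1 mulr1.
  by move: e1; rewrite X1 mul1r => ->; rewrite !expr1n.
- have Y1 : Y = 1 by move: e2; rewrite expr2 mulrA e1 mul1r.
  by move: e1; rewrite Y1 mulr1 => ->; rewrite !expr1n.
- have XY : X = Y.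
    apply: (mulfI X0); apply: (mulIf Y0); by rewrite -expr2 e1 -mulrA -expr2 e2.
  rewrite -XY in e1 *; split; apply: sX; right; by rewrite exprSr.
- by move/eqP: e1; rewrite nth_nil eq_sym oner_eq0.
Qed.

Section Orders.
Variable p : nat.
Hypothesis pp : prime p.

Lemma intr_Fp_eq0 (c : int) : (c%:~R == 0 :> 'F_p) = (p%:Z %| c)%Z.
Proof.
have ch := pchar_Fp pp.
case: c => n.
  by rewrite -[Posz n]/(n%:Z) -pmulrn -(dvdn_pcharf ch) /dvdz.
by rewrite NegzE mulrNz oppr_eq0 -pmulrn -(dvdn_pcharf ch) /dvdz.
Qed.

Lemma mult_order_dvd (c : int) m : ~~ (p%:Z %| c)%Z ->
  (mult_order p c %| m)%N = ((c%:~R : 'F_p) ^+ m == 1).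
Proof.
rewrite -intr_Fp_eq0 => c0; rewrite /mult_order order_dvdn -val_eqE /= FinRing.val_unitX.
by rewrite insubdK // unfold_in unitfE.
Qed.

Variables a b : int.
Hypothesis pab : ~~ (p%:Z %| a * b)%Z.

(** As [(Z/p)^*] is cyclic, this is the order of the subgroup generated by [a] and
    [b]. *)
Definition pair_order : nat := lcmn (mult_order p a) (mult_order p b).

Let x : 'F_p := a%:~R.
Let y : 'F_p := b%:~R.

Let pa : ~~ (p%:Z %| a)%Z.
Proof. by apply: contra pab => h; rewrite dvdz_mulr. Qed.
Let pb : ~~ (p%:Z %| b)%Z.
Proof. by apply: contra pab => h; rewrite dvdz_mull. Qed.
Let x0 : x != 0. Proof. by rewrite intr_Fp_eq0. Qed.
Let y0 : y != 0. Proof. by rewrite intr_Fp_eq0. Qed.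

Lemma pair_order_dvd m : (pair_order %| m)%N = (x ^+ m == 1) && (y ^+ m == 1).
Proof. by rewrite dvdn_lcm !mult_order_dvd. Qed.

Lemma pair_order_gt0 : (0 < pair_order)%N.
Proof. by rewrite lcmn_gt0 !order_gt0. Qed.

Lemma Fp_unit_expf (z : 'F_p) : z != 0 -> z ^+ p.-1 = 1.
Proof.
move=> z0; apply: (mulfI z0); rewrite -exprS prednK ?prime_gt0 // mulr1.
by have := expf_card z; rewrite card_Fp.
Qed.

Lemma pair_order_dvd_pred : (pair_order %| p.-1)%N.
Proof. by rewrite pair_order_dvd !Fp_unit_expf ?eqxx. Qed.

Let cs := [:: a; b; a * b; a ^+ 2 * b; a * b ^+ 2].
Let zs := [:: x; y; x * y; x ^+ 2 * y; x * y ^+ 2].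

Let zsE i : (i < 5)%N -> (cs`_i)%:~R = zs`_i :> 'F_p.
Proof. by case: i => [|[|[|[|[|i]]]]] //= _; rewrite ?rmorphM ?rmorphXn. Qed.

Let cs_unit i : (i < 5)%N -> ~~ (p%:Z %| cs`_i)%Z.
Proof.
move=> i5; rewrite -intr_Fp_eq0 zsE //.
by case: i i5 => [|[|[|[|[|i]]]]] //= _; rewrite ?mulf_neq0 ?expf_neq0.
Qed.

Let N := pair_order.

Let ord_dvd i : (i < 5)%N -> (mult_order p cs`_i %| N)%N.
Proof.
move=> i5; rewrite mult_order_dvd ?cs_unit // zsE //.
have /andP[/eqP xN /eqP yN] : (x ^+ N == 1) && (y ^+ N == 1) by rewrite -pair_order_dvd.
case: i i5 => [|[|[|[|[|i]]]]] //= _; rewrite ?exprMn ?[(_ ^+ 2) ^+ N]exprAC ?xN ?yN ?expr1n ?mulr1 //.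
Qed.

Let idx i := (N %/ mult_order p cs`_i)%N.

Let idxE i : (i < 5)%N -> (mult_order p cs`_i * idx i = N)%N.
Proof. by move=> i5; rewrite mulnC divnK // ord_dvd. Qed.

Let idx_gcd i j : (i < j < 5)%N -> (gcdn (idx i) (idx j) %| 6)%N.
Proof.
move=> /andP[ij j5]; have i5 := ltn_trans ij j5.
set g := gcdn _ _.
have gi : (g %| idx i)%N by apply: dvdn_gcdl.
have gj : (g %| idx j)%N by apply: dvdn_gcdr.
have gN : (g %| N)%N by rewrite -(idxE i5) dvdn_mull.
case/dvdnP: (gN) => e eN.
have g0 : (0 < g)%N by case: g eN pair_order_gt0 {gi gj gN} => //; rewrite muln0 /N => ->.
have one k : (k < 5)%N -> (g %| idx k)%N -> zs`_k ^+ e = 1.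
  move=> k5 /dvdnP[t tE]; apply/eqP; rewrite -zsE // -mult_order_dvd ?cs_unit //.
  have := idxE k5; rewrite tE eN mulnA => /eqP; rewrite eqn_pmul2r // => /eqP <-.
  exact: dvdn_mulr.
have zE k : (k < 5)%N -> (g %| idx k)%N ->
    [:: x ^+ e; y ^+ e; x ^+ e * y ^+ e; (x ^+ e) ^+ 2 * y ^+ e; x ^+ e * (y ^+ e) ^+ 2]`_k = 1.
  move=> k5 gk; rewrite -(one k k5 gk).
  by case: k k5 {gk} => [|[|[|[|[|k]]]]] //= _; rewrite ?exprMn ?expr2 ?exprMn.
have [X6 Y6] : (x ^+ e) ^+ 6 = 1 /\ (y ^+ e) ^+ 6 = 1.
  apply: (@six_power_pair _ _ _ i j); rewrite ?expf_neq0 ?ij ?zE //.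
have : (N %| e * 6)%N by rewrite pair_order_dvd !exprM X6 Y6 !eqxx.
by rewrite eN dvdn_pmul2l // ; move: pair_order_gt0; rewrite -/N eN muln_gt0 => /andP[].
Qed.

(** The indices [idx i] divide [N] and have pairwise gcd dividing 6, by
    [six_power_pair] applied to powers of the generators. *)
Lemma prod_five_orders_ge :
  (N ^ 4 <= 6 ^ 10 * \prod_(c <- cs) mult_order p c)%N.
Proof.
have N0 : (0 < N)%N by apply: pair_order_gt0.
pose s := [seq idx i | i <- iota 0 5].
have pw : pairwise (fun m n => gcdn m n %| 6)%N s.
  by rewrite /s /= !idx_gcd.
have sN : (foldr lcmn 1 s %| N)%N.
  rewrite /s /= !dvdn_lcm dvd1n andbT.
  have h i : (i < 5)%N -> (idx i %| N)%N by move=> i5; rewrite -[X in (_ %| X)%N](idxE i5) dvdn_mull.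
  by rewrite !h.
have := dvdn_trans (prod_dvd_lcm pw) (dvdn_mul (dvdnn _) sN).
rewrite (_ : 'C(size s, 2) = 10)%N // => /dvdn_leq; rewrite muln_gt0 N0 => /(_ isT) le.
have e : (\prod_(c <- cs) mult_order p c * \prod_(m <- s) m = N ^ 5)%N.
  rewrite (_ : cs = [seq cs`_i | i <- iota 0 5]) // /s !big_map -big_split /=.
  by rewrite !big_cons big_nil !idxE // !expnS expn0.
rewrite -(leq_pmul2r N0) -expnSr -e mulnAC mulnC leq_mul2r le orbT //.
Qed.
End Orders.

(** * Primes for which two generators have a small order *)

(** The polynomial [X ^ N - 1] has at most [N] roots. *)
Lemma two_generator_collision (K : fieldType) (x y : K) (N H : nat) :
  x != 0 -> y != 0 -> x ^+ N = 1 -> y ^+ N = 1 -> (0 < N)%N -> (N < H.+1 ^ 2)%N ->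
  exists u v, [/\ (u <= H)%N, (v <= H)%N, (0 < u + v)%N &
    x ^+ u * y ^+ v = 1 \/ x ^+ u = y ^+ v].
Proof.
move=> x0 y0 xN yN N0 NH.
pose f (ij : 'I_H.+1 * 'I_H.+1) := x ^+ ij.1 * y ^+ ij.2.
have [/injectiveP fi|/injectivePn[[i j] [[k l] ne]]] := boolP (injectiveb f).
  have : (size [seq f ij | ij <- enum {: 'I_H.+1 * 'I_H.+1}] <= N)%N.
    apply: max_unity_roots => //; last by rewrite map_inj_uniq ?enum_uniq.
    apply/allP => z /mapP[ij _ ->]; rewrite unity_rootE /f exprMn -!exprM.
    by rewrite ![(_ * N)%N]mulnC !exprM xN yN !expr1n mulr1.
  by rewrite size_map -cardE card_prod card_ord leqNgt mulnn NH.
rewrite /f /=; move: ne; rewrite xpair_eqE -!val_eqE /=.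
have := ltn_ord i; have := ltn_ord j; have := ltn_ord k; have := ltn_ord l.
move: (nat_of_ord i) (nat_of_ord j) (nat_of_ord k) (nat_of_ord l) => {f} {}i {}j {}k {}l.
rewrite !ltnS; wlog ik : i j k l / (i <= k)%N => [W|] lH kH jH iH ne e.
  have [ik|/ltnW ki] := leqP i k; first exact: (W i j k l).
  by apply: (W k l i j) => //; rewrite eq_sym [l == _]eq_sym.
have xi : x ^+ i != 0 by rewrite expf_neq0.
have yj : y ^+ j != 0 by rewrite expf_neq0.
have yl : y ^+ l != 0 by rewrite expf_neq0.
have [jl|/ltnW lj] := leqP j l.
  exists (k - i)%N, (l - j)%N; split; [lia|lia| |left].
    by move: ne; rewrite negb_and; case/orP => /eqP; lia.
  apply: (mulfI xi); apply: (mulfI yj); rewrite mulr1 [RHS]mulrC e.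
  by rewrite -(subnK ik) -(subnK jl) !exprD !addnK; ring.
exists (k - i)%N, (j - l)%N; split; [lia|lia| |right].
  by move: ne; rewrite negb_and; case/orP => /eqP; lia.
apply: (mulfI xi); apply: (mulfI yl).
have -> : y ^+ l * (x ^+ i * y ^+ (j - l)) = x ^+ i * y ^+ j.
  by rewrite -{2}(subnK lj) exprD; ring.
by rewrite e -{2}(subnK ik) exprD; ring.
Qed.

Lemma prod_primes_dvd (s : seq nat) n : uniq s -> all (fun q => prime q && (q %| n)%N) s ->
  (\prod_(q <- s) q %| n)%N.
Proof.
elim: s => [|q s IH] /=; first by rewrite big_nil dvd1n.
case/andP => qs us /andP[/andP[pq qn] hs]; rewrite big_cons Gauss_dvd ?qn ?IH //.
rewrite prime_coprime // Euclid_dvd_prod // big_has; apply/hasPn => r rs.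
have /andP[pr _] := allP hs r rs.
by rewrite dvdn_prime2 //; apply: contraNneq qs => ->.
Qed.

Lemma count_prime_divisors n X : (0 < n)%N ->
  (2 ^ (\sum_(0 <= q < X | prime q && (q %| n)) 1) <= n)%N.
Proof.
move=> n0; rewrite sum1_count -size_filter; set s := [seq q <- _ | _].
have us : uniq s by rewrite filter_uniq ?iota_uniq.
have hs : all (fun q => prime q && (q %| n)%N) s by apply: filter_all.
apply: leq_trans (dvdn_leq n0 (prod_primes_dvd us hs)).
elim: s hs {us} => [|q s IH] /=; first by rewrite big_nil.
case/andP => /andP[pq _] /IH h; rewrite big_cons expnS leq_mul // prime_gt1 //.
Qed.

Section SmallOrder.
Variables (a b : int).
Hypothesis a0 : a != 0.
Hypothesis b0 : b != 0.
Hypothesis indep : mult_independent [tuple a%:Q; b%:Q].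

Lemma indep_int (e1 e2 : int) : (a%:Q) ^ e1 * (b%:Q) ^ e2 = 1 -> e1 = 0 /\ e2 = 0.
Proof.
move=> h; have := indep (e := fun i : 'I_2 => if i == ord0 then e1 else e2).
rewrite big_ord_recl big_ord1 /= !(tnth_nth 0) /= => /(_ h) H.
by split; [exact: (H ord0)|exact: (H (lift ord0 ord0))].
Qed.

(** An integer that [p] divides when [x ^ u * y ^ v = 1] or [x ^ u = y ^ v] for the
    classes [x], [y] of [a], [b]. *)
Definition collision_factor (u v : nat) : nat :=
  (`|(a ^+ u * b ^+ v - 1)%R| * `|(a ^+ u - b ^+ v)%R|)%N.

Lemma collision_factor_gt0 u v : (0 < u + v)%N -> (0 < collision_factor u v)%N.
Proof.
move=> uv; rewrite muln_gt0 !absz_gt0 !subr_eq0.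
have bQ : b%:Q != 0 by rewrite intr_eq0.
apply/andP; split; apply/eqP => e.
  have /indep_int[[u0] [v0]] : a%:Q ^ (Posz u) * b%:Q ^ (Posz v) = 1.
    by rewrite -!exprnP -!rmorphXn -rmorphM /= e.
  by rewrite u0 v0 in uv.
have /indep_int[[u0] v0] : a%:Q ^ (Posz u) * b%:Q ^ (- Posz v) = 1.
  by rewrite -exprnN -!exprnP -!rmorphXn /= e divff // rmorphXn expf_neq0.
by case: v v0 uv {e} => //; rewrite u0.
Qed.

Lemma collision_factor_le c H u v : (`|a| <= 2 ^ c)%N -> (`|b| <= 2 ^ c)%N ->
  (u <= H)%N -> (v <= H)%N -> (collision_factor u v <= 2 ^ (2 * (1 + 2 * (c * H))))%N.
Proof.
move=> ac bc uH vH; rewrite mul2n -addnn expnD.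
have au : (`|a ^+ u| <= 2 ^ (c * H))%N.
  rewrite abszX; apply: (@leq_trans ((2 ^ c) ^ u)); first by case: (u) => // k; rewrite leq_exp2r.
  by rewrite -expnM leq_exp2l // leq_mul2l uH orbT.
have bv : (`|b ^+ v| <= 2 ^ (c * H))%N.
  rewrite abszX; apply: (@leq_trans ((2 ^ c) ^ v)); first by case: (v) => // k; rewrite leq_exp2r.
  by rewrite -expnM leq_exp2l // leq_mul2l vH orbT.
have h1 : (`|(a ^+ u * b ^+ v - 1)%R| <= 2 ^ (c * H) * 2 ^ (c * H) + 1)%N.
  have : (`|(a ^+ u * b ^+ v)%R| <= 2 ^ (c * H) * 2 ^ (c * H))%N by rewrite abszM leq_mul.
  lia.
have h2 : (`|(a ^+ u - b ^+ v)%R| <= 2 ^ (c * H) + 2 ^ (c * H))%N by lia.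
have e : (2 ^ (1 + 2 * (c * H)) = 2 * (2 ^ (c * H) * 2 ^ (c * H)))%N.
  by rewrite add1n expnS [(2 * (c * H))%N]mul2n -addnn expnD.
have p0 : (0 < 2 ^ (c * H))%N by rewrite expn_gt0.
by rewrite /collision_factor leq_mul // e; nia.
Qed.

(** The primes counted divide the product of all collision factors, an integer with
    [O(H ^ 3)] bits. *)
Lemma small_order_count c H X : (`|a| <= 2 ^ c)%N -> (`|b| <= 2 ^ c)%N -> (0 < H)%N ->
  (\sum_(0 <= p < X | [&& prime p, ~~ (p%:Z %| (a * b)%R)%Z & pair_order p a b < H.+1 ^ 2]) 1
   <= 8 * (1 + 2 * c) * H ^ 3 * 2)%N.
Proof.
move=> ac bc H0.
pose D := (\prod_(uv : 'I_H.+1 * 'I_H.+1 | 0 < uv.1 + uv.2) collision_factor uv.1 uv.2)%N.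
have D0 : (0 < D)%N by apply: prodn_cond_gt0 => uv; apply: collision_factor_gt0.
have DL : (D <= 2 ^ (2 * (1 + 2 * (c * H)) * H.+1 ^ 2))%N.
  apply: (@leq_trans (\prod_(uv : 'I_H.+1 * 'I_H.+1) 2 ^ (2 * (1 + 2 * (c * H))))); last first.
    by rewrite prod_nat_const card_prod !card_ord -expnM mulnn.
  rewrite /D big_mkcond; apply: leq_prod => uv _; case: ifP => _; last by rewrite expn_gt0.
  by apply: collision_factor_le; rewrite // -ltnS ltn_ord.
apply: (@leq_trans (\sum_(0 <= p < X | prime p && (p %| D)) 1)%N); last first.
  have := leq_trans (count_prime_divisors X D0) DL; rewrite leq_exp2l //.
  move/leq_trans; apply.
  have e : (H.+1 ^ 2 <= 4 * H ^ 2)%N by rewrite -!mulnn; nia.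
  apply: (@leq_trans (2 * ((1 + 2 * c) * H) * (4 * H ^ 2))%N).
    by rewrite leq_mul // leq_mul2l /=; nia.
  by rewrite !expnS expn0; lia.
rewrite big_mkcond [X in (_ <= X)%N]big_mkcond /=; apply: leq_sum => p _.
case: ifP => // /and3P[pp pab small]; rewrite pp /=.
suff -> : (p %| D)%N by [].
have pa : ~~ (p%:Z %| a)%Z by apply: contra pab => h; rewrite dvdz_mulr.
have pb : ~~ (p%:Z %| b)%Z by apply: contra pab => h; rewrite dvdz_mull.
have := dvdnn (pair_order p a b); rewrite {2}/pair_order.
rewrite (pair_order_dvd pp pab) => /andP[/eqP xN /eqP yN].
have [|||u [v [uH vH uv col]]] := two_generator_collision _ _ xN yN _ small.
- by rewrite intr_Fp_eq0.
- by rewrite intr_Fp_eq0.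
- exact: pair_order_gt0.
rewrite /D (bigD1 (inord u, inord v)) /= ?inordK ?ltnS // dvdn_mulr // Euclid_dvdM //.
case: col => h; apply/orP; [left|right].
  have : (p%:Z %| (a ^+ u * b ^+ v - 1)%R)%Z.
    by rewrite -intr_Fp_eq0 // rmorphB rmorphM !rmorphXn rmorph1 /= h subrr.
  by rewrite /dvdz.
have : (p%:Z %| (a ^+ u - b ^+ v)%R)%Z.
  by rewrite -intr_Fp_eq0 // rmorphB !rmorphXn /= h subrr.
by rewrite /dvdz.
Qed.
End SmallOrder.

(** * Primes and atypical cofactors in a progression *)

Lemma sum_prime_upto (V : nmodType) (R : nat) (P : pred nat) (f : nat -> V) :
  \sum_(i : prime_upto R | P (prime_val i)) f (prime_val i) = \sum_(0 <= q < R.+1 | prime q && P q) f q.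
Proof.
rewrite big_mkord (reindex_omap (fun i : prime_upto R => val i) insub); last first.
  by move=> i /andP[pi _]; rewrite insubT.
by apply: eq_bigl => i; rewrite (prime_val_prime i) valK eqxx andbT.
Qed.

Section Windows.
Variable F : realType.

Lemma window_massE R y : window_mass F R y = \sum_(y.+1 <= q < R.+1 | prime q) (q%:R : F)^-1.
Proof.
rewrite /window_mass (eq_bigl (fun i => (y < prime_val i)%N)); last by move=> i; rewrite inE.
rewrite (sum_prime_upto R (fun q => (y < q)%N) (fun q => (q%:R : F)^-1)).
have [yR|Ry] := leqP y R; last first.
  rewrite [RHS]big_geq; last by lia.
  rewrite big_nat_cond big_pred0 // => q; apply/negP => /andP[/andP[_ qR] /andP[_ yq]]; lia.
rewrite (@big_cat_nat _ _ _ y.+1) //= big_nat_cond big_pred0 ?add0r; last first.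
  by move=> q; apply/negP => /andP[/andP[_ qy] /andP[_ yq]]; lia.
rewrite big_nat_cond [RHS]big_nat_cond; apply: eq_bigl => q.
by case: (leqP y.+1 q) => //=; rewrite andbT.
Qed.

Lemma window_mass_le R y : (0 < y)%N -> (0 < R)%N -> window_mass F R y <= 1 + ln R%:R.
Proof.
move=> y0 R0; rewrite window_massE; have [yR|Ry] := leqP y.+1 R; last first.
  by rewrite big_geq // addr_ge0 ?ln_nat_ge0.
have := @harmonic_interval_le F y.+1 R isT yR; have := ln_nat_ge0 F y.+1 => h1 h2.
apply: (@le_trans _ _ (\sum_(y.+1 <= q < R.+1) (q%:R : F)^-1)); last by lra.
by rewrite big_mkcond; apply: ler_sum => q _; case: ifP; rewrite ?invr_ge0.
Qed.

Lemma expr1D_le (s : F) k : 0 <= s -> 2 * k%:R * s <= 1 -> (1 + s) ^+ k <= 1 + 2 * k%:R * s.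
Proof.
move=> s0; elim: k => [|k IH]; first by rewrite expr0 mulr0 mul0r addr0.
rewrite -natr1 => h; have k0 : 0 <= k%:R :> F by [].
have /IH {}IH : 2 * k%:R * s <= 1 by nra.
rewrite exprSr; apply: (@le_trans _ _ ((1 + 2 * k%:R * s) * (1 + s))).
  by rewrite ler_wpM2r // addr_ge0.
have : 2 * k%:R * s * s <= 1 * s by apply: ler_wpM2r => //; lra.
lra.
Qed.

(** Such an [m] has at most [t] prime factors, all of them above [2 * t]. *)
Lemma euler_factor_rough R y m t : (0 < y)%N -> (0 < m)%N -> (2 * t <= y)%N -> (m < y.+1 ^ t.+1)%N ->
  [pred q | (y < q)%N].-nat m -> euler_factor F (@prime_val R) [set i | prime_val i %| m]%N <= 2.
Proof.
move=> y0 m0 ty mt /andP[_ /allP rm]; set T := [set i | _].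
have big i : i \in T -> (y < prime_val i)%N.
  rewrite inE => im; apply: (rm (prime_val i)); by rewrite mem_primes prime_val_prime m0.
have yF : 0 < y%:R :> F by rewrite ltr0n.
have Tt : (#|T| <= t)%N.
  have dT : (subset_prod (@prime_val R) T %| m)%N by rewrite subset_prod_dvdE; apply/forall_inP => i; rewrite inE.
  have : (y.+1 ^ #|T| <= subset_prod (@prime_val R) T)%N.
    by rewrite -prod_nat_const; apply: leq_prod => i /big.
  move/leq_trans/(_ (dvdn_leq m0 dT)) => /leq_ltn_trans/(_ mt).
  by rewrite ltn_exp2l ?ltnS.
apply: (@le_trans _ _ ((1 + y%:R^-1) ^+ #|T|)).
  rewrite -prodr_const; apply: ler_prod => i /big yi.
  have h : y%:R + 1 <= (prime_val i)%:R :> F by rewrite natr1 ler_nat.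
  rewrite addr_ge0 ?invr_ge0 //=; last by lra.
  by rewrite lerD2l lef_pV2 ?posrE; lra.
have h : 2 * #|T|%:R * y%:R^-1 <= 1 :> F.
  rewrite ler_pdivrMr // mul1r -natrM ler_nat; apply: leq_trans ty; by rewrite leq_mul2l Tt orbT.
apply: le_trans (expr1D_le _ h) _; [by rewrite invr_ge0 ltW|lra].
Qed.

Lemma euler_factor_prime_power R q k : prime q ->
  euler_factor F (@prime_val R) [set i | prime_val i %| q ^ k]%N <= 2.
Proof.
move=> pq; set T := [set i | _].
have qT i : i \in T -> prime_val i = q.
  rewrite inE Euclid_dvdX ?prime_val_prime // => /andP[+ _].
  by rewrite dvdn_prime2 ?prime_val_prime // => /eqP.
have [->|[i iT]] := set_0Vmem T; first by rewrite /euler_factor big_set0; lra.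
have -> : T = [set i].
  apply/setP => j; rewrite inE; apply/idP/eqP => [jT|-> //].
  by apply: (@prime_val_inj R); rewrite (qT j) // (qT i).
rewrite /euler_factor big_set1 (qT i) //.
have q2 : 2 <= q%:R :> F by rewrite ler_nat prime_gt1.
have : (q%:R - 1)^-1 <= 1 :> F by rewrite invf_le1; lra.
lra.
Qed.

Section Fixed.
Variables (R y : nat).
Hypothesis R1 : (1 < R)%N.
Local Notation L := (window_mass F R y).

Let lnR : 0 < ln (R%:R : F). Proof. by apply: ln_gt0; rewrite ltr1n. Qed.
Let R0 : (0 < R)%N. Proof. exact: ltnW. Qed.

Lemma sieve_mass_ge_ln M : euler_factor F (@prime_val R) [set i | prime_val i %| M]%N <= 2 ->
  ln R%:R / 4 <= sieve_mass F (@prime_val R) (sieve_supp R M).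
Proof.
move=> /(harmonic_le_sieve_mass R0) h; have := ln_le_harmonic F R; lra.
Qed.

Lemma prime_class_count M X : euler_factor F (@prime_val R) [set i | prime_val i %| M]%N <= 2 ->
  (\sum_(0 <= e < X | prime (M * e + 1) && (R < M * e + 1)%N) 1)%N%:R <=
  4 * X%:R / ln R%:R + R%:R ^+ 4 :> F.
Proof.
move=> e2; apply: le_trans (prime_count_le F M X R0) _; rewrite lerD2r.
have g := sieve_mass_ge_ln e2.
have g0 : 0 < sieve_mass F (@prime_val R) (sieve_supp R M) by apply: lt_le_trans g; rewrite divr_gt0.
rewrite ler_pdivrMr //.
have -> : 4 * X%:R / ln R%:R * sieve_mass F (@prime_val R) (sieve_supp R M) =
  X%:R * (sieve_mass F (@prime_val R) (sieve_supp R M) / (ln R%:R / 4)) by field; rewrite gt_eqF.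
by rewrite ler_peMr // ler_pdivlMr ?divr_gt0 // mul1r.
Qed.

(** A deviation of [L / 4] is what makes two typical cofactors contradict a
    typical product: [3/4 + 3/4 > 5/4]. *)
Definition atypical (e : nat) : bool := (L / 4 <= `|(window_omega R y e)%:R - L|)%R.

Hypothesis y_gt0 : (0 < y)%N.
Hypothesis L_ge1 : 1 <= L.
Hypothesis L_small : 17 * L <= y%:R.

(** The hypothesis [R ^ 7 <= X] makes the error term of [atypical_count_le]
    negligible. *)
Lemma atypical_class_count M X : euler_factor F (@prime_val R) [set i | prime_val i %| M]%N <= 2 ->
  (R ^ 7 <= X)%N ->
  (\sum_(0 <= e < X | [&& prime (M * e + 1), (R < M * e + 1)%N & atypical e]) 1)%N%:R <=
  336 * X%:R / (L * ln R%:R) :> F.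
Proof.
move=> e2 RX; apply: le_trans (atypical_count_le M X R0 y_gt0 L_ge1 L_small) _.
have g := sieve_mass_ge_ln e2; set G := sieve_mass _ _ _ in g *.
have g0 : 0 < G by apply: lt_le_trans g; rewrite divr_gt0.
have L0 : 0 < L by apply: lt_le_trans L_ge1.
have XF : 0 <= X%:R :> F by [].
have a1 : 48 * X%:R / (L * G) <= 192 * X%:R / (L * ln R%:R).
  rewrite ler_pdivrMr ?mulr_gt0 //.
  have -> : 192 * X%:R / (L * ln R%:R) * (L * G) = 48 * X%:R * (G / (ln R%:R / 4)).
    by field; rewrite !gt_eqF.
  by rewrite ler_peMr ?mulr_ge0 // ler_pdivlMr ?divr_gt0 // mul1r.
have a2 : 144 * R%:R ^+ 6 / L ^+ 2 <= 144 * X%:R / (L * ln R%:R).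
  have RF : 0 < R%:R :> F by rewrite ltr0n.
  have lR : ln R%:R <= R%:R :> F by apply/ltW/ln_sublinear.
  have RX' : R%:R ^+ 7 <= X%:R :> F by rewrite -natrX ler_nat.
  rewrite ler_pdivrMr ?exprn_gt0 //.
  have -> : 144 * X%:R / (L * ln R%:R) * L ^+ 2 = 144 * (X%:R / ln R%:R) * L.
    by field; rewrite !gt_eqF.
  apply: (@le_trans _ _ (144 * (X%:R / ln R%:R))); last by rewrite ler_peMr // mulr_ge0 // divr_ge0 // ltW.
  rewrite ler_pM2l // ler_pdivlMr //; apply: le_trans RX'.
  by rewrite [X in _ <= X]exprSr ler_wpM2l // exprn_ge0.
apply: le_trans (lerD a1 a2) _; rewrite -mulrDl -mulrDl; lra.
Qed.
End Fixed.
End Windows.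

(** * Exceptional shifted primes *)

Lemma count_multiples_reindex (P : pred nat) m x : (0 < m)%N ->
  (\sum_(0 <= n < x | (m %| n) && P n) 1 <= \sum_(0 <= e < (x %/ m).+1 | P (m * e)) 1)%N.
Proof.
move=> m0; rewrite !sum1_count -!size_filter -[X in (_ <= X)%N](size_map (muln m)).
apply: uniq_leq_size; first by rewrite filter_uniq ?iota_uniq.
move=> n; rewrite mem_filter mem_index_iota => /andP[/andP[/dvdnP[e ->] Pe] /andP[_ nx]].
rewrite mulnC map_f // mem_filter mulnC Pe mem_index_iota /= ltnS leq_divRL //.
exact: ltnW.
Qed.

Lemma count_pos_multiples d x : (0 < d)%N ->
  (\sum_(0 <= n < x | (0 < n) && (d %| n)) 1 <= x %/ d)%N.
Proof.
move=> d0; rewrite sum1_count -size_filter -[X in (_ <= X)%N](size_iota 1) -[X in (_ <= X)%N](size_map (muln d)).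
apply: uniq_leq_size; first by rewrite filter_uniq ?iota_uniq.
move=> n; rewrite mem_filter mem_index_iota => /andP[/andP[+ /dvdnP[e nE]] /andP[_ nx]].
rewrite nE muln_gt0 => /andP[e0 _]; rewrite mulnC map_f // mem_iota e0 add1n ltnS leq_divRL //.
by rewrite -nE ltnW.
Qed.

Lemma succ_div_mul_le m x : (m <= x)%N -> ((x %/ m).+1 * m <= 2 * x)%N.
Proof. by move=> mx; rewrite mulSn mul2n -addnn leq_add // leq_divM. Qed.

Section Counts.
Variable F : realType.

Lemma count_has_le (P : nat -> nat -> bool) (Q : pred nat) (s : seq nat) x :
  (\sum_(0 <= n < x | Q n && has (P n) s) 1)%N%:R <=
   \sum_(m <- s) (\sum_(0 <= n < x | Q n && P n m) 1)%N%:R :> F.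
Proof.
rewrite -natr_sum ler_nat; elim: s => [|m s IH].
  by rewrite big_nil big_pred0 // => n; rewrite /= andbF.
rewrite big_cons; apply: leq_trans (leq_add (leqnn _) IH).
rewrite big_mkcond [X in (_ <= X + _)%N]big_mkcond [X in (_ <= _ + X)%N]big_mkcond -big_split /=.
apply: leq_sum => n _; by case: (Q n) => //=; case: (P n m); case: (has _ _).
Qed.

Section Divisors.
Variable y : nat.
Hypothesis y0 : (0 < y)%N.

(** The prime powers dividing [n] serve as moduli in [prime_class_count], which
    is of the right order only for moduli that are small compared with [x]. *)
Definition small_prime_powers (Bd n : nat) := all (fun q => prime q ==> (q ^ logn q n <= Bd)%N) (index_iota 0 y.+1).
Definition smooth_part (n : nat) : nat := (n`_[pred q | (q <= y)%N])%N.

(** For each prime [q <= y], consider the least power of [q] exceeding [Bd]. *)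
Lemma large_prime_power_count x Bd : (0 < Bd)%N ->
  (\sum_(0 <= n < x | (0 < n)%N && ~~ small_prime_powers Bd n) 1)%N%:R <= 2 * y%:R * x%:R / Bd%:R :> F.
Proof.
move=> B0; pose kq q := (trunc_log q Bd).+1.
apply: (@le_trans _ _ ((\sum_(0 <= n < x | (0 < n)%N &&
    has (fun q => prime q && (q ^ kq q %| n)%N) (index_iota 0 y.+1)) 1)%N%:R)).
  rewrite ler_nat big_mkcond [X in (_ <= X)%N]big_mkcond; apply: leq_sum => n _.
  case: ifP => // /andP[n0 /allPn[q qy]]; rewrite negb_imply -ltnNge => /andP[pq qB].
  rewrite n0 ifT //; apply/hasP; exists q => //; rewrite pq pfactor_dvdn // /kq.
  have := @trunc_logP q Bd (prime_gt1 pq) B0 => h.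
  by have := leq_ltn_trans h qB; rewrite ltn_exp2l // prime_gt1.
apply: le_trans (count_has_le _ _ _ _) _.
have BF : 0 < Bd%:R :> F by rewrite ltr0n.
apply: (@le_trans _ _ (\sum_(0 <= q < y.+1) x%:R / Bd%:R)).
  apply: ler_sum => q _; case: (boolP (prime q)) => pq; last first.
    by rewrite big_pred0 ?divr_ge0 // => n; rewrite andbF.
  have h0 : (0 < q ^ kq q)%N by rewrite expn_gt0 prime_gt0.
  have := count_pos_multiples x h0; rewrite -(ler_nat F) => h; apply: le_trans h _.
  rewrite ler_pdivlMr // -natrM ler_nat.
  apply: leq_trans (leq_divM x (q ^ kq q)); rewrite leq_mul2l; apply/orP; right.
  exact/ltnW/trunc_log_ltn/prime_gt1.
rewrite sumr_const_nat subn0 -[X in X <= _]mulr_natl mulrA ler_pM2r ?invr_gt0 // ler_wpM2r //.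
by rewrite -natrM ler_nat; lia.
Qed.

Lemma square_count x :
  (\sum_(0 <= n < x | (0 < n)%N &&
     has (fun q => (q ^ 2 %| n)%N) (index_iota y.+1 x)) 1)%N%:R <= x%:R / y%:R :> F.
Proof.
apply: le_trans (count_has_le _ _ _ _) _.
have yF : 0 < y%:R :> F by rewrite ltr0n.
apply: (@le_trans _ _ (x%:R * \sum_(y.+1 <= q < x) (q%:R ^+ 2)^-1)).
  rewrite mulr_sumr; apply: ler_sum_nat => q /andP[yq _].
  have h0 : (0 < q ^ 2)%N by rewrite expn_gt0; lia.
  have := count_pos_multiples x h0; rewrite -(ler_nat F) => h; apply: le_trans h _.
  have qF : 0 < q%:R ^+ 2 :> F by rewrite -natrX ltr0n.
  by rewrite ler_pdivlMr // -natrX -natrM ler_nat leq_divM.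
rewrite ler_wpM2l //.
have h t : \sum_(y.+1 <= q < y.+1 + t) (q%:R ^+ 2)^-1 <= y%:R^-1 - (y + t)%N%:R^-1 :> F.
  elim: t => [|t IH]; first by rewrite addn0 big_geq // addn0 subrr.
  rewrite addnS big_nat_recr /=; last by lia.
  have hs : ((y.+1 + t)%N%:R ^+ 2)^-1 <= (y + t)%N%:R^-1 - (y + t).+1%:R^-1 :> F.
    have a0 : 0 < (y + t)%N%:R :> F by rewrite ltr0n addn_gt0 y0.
    rewrite addSn; have e : (y + t).+1%:R = (y + t)%N%:R + 1 :> F by rewrite natr1.
    have -> : (y + t)%N%:R^-1 - (y + t).+1%:R^-1 = ((y + t)%N%:R * (y + t).+1%:R)^-1 :> F.
      rewrite e; field; apply/andP; split; lra.
    have p1 : 0 < (y + t).+1%:R :> F by rewrite ltr0n.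
    rewrite lef_pV2 ?posrE ?(mulr_gt0 a0 p1) ?(exprn_gt0 2 p1) //.
    by rewrite expr2 ler_pM2r // ler_nat.
  by apply: le_trans (lerD IH hs) _; rewrite addrA subrK addnS.
have [xy|yx] := leqP x y.+1; first by rewrite big_geq // invr_ge0 ltW.
rewrite -(subnKC (ltnW yx)); apply: le_trans (h _) _; by rewrite gerBl invr_ge0.
Qed.
End Divisors.

Section Fixed.
Variables (R y : nat).
Hypothesis R1 : (1 < R)%N.
Hypothesis lny : 1 <= ln (y%:R : F).
Local Notation L := (window_mass F R y).
Local Notation atypical := (atypical F R y).
Let lnR : 0 < ln (R%:R : F). Proof. by apply: ln_gt0; rewrite ltr1n. Qed.
Let y1 : (1 < y)%N.
Proof.
rewrite ltnNge; apply/negP => yle; have : ln (y%:R : F) <= 0 by apply: ln_le0; rewrite lern1.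
by move/(le_trans lny); rewrite ler10.
Qed.
Let y0 : (0 < y)%N. Proof. exact: ltnW. Qed.

Definition rough (m : nat) := [pred q | (y < q)%N].-nat m.

Lemma ln_smooth_part n : (0 < n)%N ->
  ln ((smooth_part y n)%:R : F) = \sum_(0 <= q < y.+1 | prime q) (logn q n)%:R * ln q%:R.
Proof.
move=> n0; rewrite /smooth_part.
rewrite (widen_partn _ (leq_addr y n)).
have gt0 (q : nat) : (0 < q ^ logn q n)%N by case: q => // ; rewrite lognE.
transitivity (\sum_(0 <= q < (n + y).+1 | (q <= y)%N) ln ((q ^ logn q n)%N%:R : F)).
  elim: (n + y).+1 => [|m IH]; first by rewrite !big_geq // ln1.
  rewrite big_mkcond [RHS]big_mkcond !big_nat_recr //= -big_mkcond -[X in _ = X + _]big_mkcond -IH.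
  rewrite inE; case: ifP => _; last by rewrite muln1 addr0.
  by rewrite ln_natM // prodn_cond_gt0.
have h : (y.+1 <= (n + y).+1)%N by lia.
rewrite (@big_cat_nat _ _ _ y.+1) //= [X in _ + X]big_nat_cond [X in _ + X]big_pred0 ?addr0; last first.
  by move=> q; apply/negP => /andP[/andP[yq _] qy]; lia.
rewrite big_nat_cond [RHS]big_mkcond [RHS]big_nat_cond.
rewrite [LHS](eq_bigl (fun q => (0 <= q < y.+1)%N && true)); last first.
  by move=> q /=; rewrite andbT ltnS andbb.
apply: eq_bigr => q _; case: ifP => [pq|npq]; first by rewrite ln_natX // prime_gt0.
by rewrite lognE npq ln1.
Qed.

(** The logarithm of the smooth part is a sum of [ln q] over the prime powers
    [q ^ k] dividing [n]; count the primes [n + 1] in each of these progressions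
    and use [sum_ln_prime_div_le]. *)
Lemma smooth_log_sum x Bd : (R ^ 5 * Bd <= x)%N ->
  \sum_(0 <= n < x | [&& prime n.+1, (R < n.+1)%N & small_prime_powers y Bd n]) ln ((smooth_part y n)%:R : F) <=
  36 * x%:R * ln y%:R / ln R%:R.
Proof.
move=> xbig.
have xF : 0 <= x%:R :> F by [].
apply: (@le_trans _ _ (\sum_(0 <= q < y.+1 | prime q) \sum_(1 <= k < Bd.+1 | (q ^ k <= Bd)%N)
   ln (q%:R : F) * (\sum_(0 <= n < x | prime n.+1 && (R < n.+1)%N && (q ^ k %| n)%N) 1)%N%:R)).
  apply: (@le_trans _ _ (\sum_(0 <= n < x | prime n.+1 && (R < n.+1)%N)
     \sum_(0 <= q < y.+1 | prime q) \sum_(1 <= k < Bd.+1 | (q ^ k <= Bd)%N) ln (q%:R : F) * (q ^ k %| n)%N%:R)).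
    rewrite big_mkcond [X in _ <= X]big_mkcond; apply: ler_sum => n _.
    case: (boolP (prime n.+1)) => //= pn; case: (boolP (R < n.+1)%N) => //= Rn.
    have n0 : (0 < n)%N by lia.
    have p0 : 0 <= \sum_(0 <= q < y.+1 | prime q) \sum_(1 <= k < Bd.+1 | (q ^ k <= Bd)%N) ln (q%:R : F) * (q ^ k %| n)%N%:R.
      by apply: sumr_ge0 => q _; apply: sumr_ge0 => k _; rewrite mulr_ge0 ?ln_nat_ge0.
    case: ifP => gn //; rewrite ln_smooth_part //.
    rewrite [X in X <= _]big_nat_cond [X in _ <= X]big_nat_cond; apply: ler_sum => q /andP[qy pq].
    rewrite -mulr_sumr mulrC ler_wpM2l ?ln_nat_ge0 // -natr_sum ler_nat.
    have gq : (q ^ logn q n <= Bd)%N.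
      by have := allP gn q; rewrite mem_index_iota qy pq => /(_ isT).
    have lB : (logn q n <= Bd)%N by apply: leq_trans gq; apply/ltnW/ltn_expl/prime_gt1.
    rewrite (@big_cat_nat _ _ _ (logn q n).+1) //=; apply: leq_trans (leq_addr _ _).
    rewrite big_mkcond /= (@leq_trans (\sum_(1 <= k < (logn q n).+1) 1)%N) //.
      by rewrite sum_nat_const_nat subn1 muln1.
    rewrite big_nat_cond [X in (_ <= X)%N]big_nat_cond; apply: leq_sum => k /andP[/andP[k1 kl] _].
    rewrite ltnS in kl; rewrite ifT; last by apply: leq_trans gq; rewrite leq_exp2l // prime_gt1.
    by rewrite pfactor_dvdn // kl.
  rewrite exchange_big /=; apply: ler_sum => q pq.
  rewrite exchange_big /=; apply: ler_sum => k _.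
  rewrite -mulr_sumr ler_wpM2l ?ln_nat_ge0 // natr_sum [X in _ <= X]big_mkcondr /=.
  by apply: ler_sum => n _; case: ifP.
apply: (@le_trans _ _ (\sum_(0 <= q < y.+1 | prime q) 18 * x%:R / ln R%:R * (ln q%:R / q%:R))); last first.
  rewrite -mulr_sumr.
  apply: (@le_trans _ _ (18 * x%:R / ln R%:R * (2 * ln y%:R))).
    rewrite ler_wpM2l ?sum_ln_prime_div_le //; by rewrite divr_ge0 ?mulr_ge0 // ltW.
  by rewrite le_eqVlt; apply/orP; left; apply/eqP; ring.
apply: ler_sum => q pq; have q1 := prime_gt1 pq; have q0 := ltnW q1.
rewrite -mulr_sumr.
apply: (@le_trans _ _ (ln q%:R * (9 * x%:R / ln R%:R * (q%:R - 1)^-1))); last first.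
  have h := @prime_pred_le2 F q (ln q%:R) pq (ln_nat_ge0 F q).
  have c0 : 0 <= 9 * x%:R / ln R%:R :> F by rewrite divr_ge0 ?mulr_ge0 // ltW.
  have -> : ln q%:R * (9 * x%:R / ln R%:R * (q%:R - 1)^-1) =
    9 * x%:R / ln R%:R * (ln q%:R / (q%:R - 1)) :> F by ring.
  have -> : 18 * x%:R / ln R%:R * (ln q%:R / q%:R) =
    9 * x%:R / ln R%:R * (2 * (ln q%:R / q%:R)) :> F by ring.
  by apply: ler_wpM2l.
rewrite ler_wpM2l ?ln_nat_ge0 //.
have c0 : 0 <= 9 * x%:R / ln R%:R :> F by rewrite divr_ge0 ?mulr_ge0 // ltW.
apply: le_trans (_ : 9 * x%:R / ln R%:R * \sum_(1 <= k < Bd.+1) (q ^ k)%N%:R^-1 <= _); last first.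
  by apply: ler_wpM2l => //; apply: geom_le.
rewrite mulr_sumr big_mkcond; apply: ler_sum => k _.
have qk0 : (0 < q ^ k)%N by rewrite expn_gt0 q0.
case: ifP => qk; last by rewrite mulr_ge0 // invr_ge0.
have eu := @euler_factor_prime_power F R q k pq.
have := @prime_class_count F R R1 (q ^ k)%N (x %/ q ^ k).+1 eu.
set C := \sum_(0 <= e < _ | _) 1 => hC.
apply: (@le_trans _ _ C%:R).
  rewrite ler_nat.
  have := count_multiples_reindex (fun n => prime n.+1 && (R < n.+1)%N) x qk0.
  move=> h; apply: leq_trans (leq_trans h _).
    by apply: eq_leq; apply: eq_bigl => n; rewrite andbC.
  by apply: eq_leq; apply: eq_bigl => e; rewrite addn1.
apply: le_trans hC _.
have qkF : 0 < (q ^ k)%N%:R :> F by rewrite ltr0n.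
have RBx : (R ^ 5 * q ^ k <= x)%N by apply: leq_trans xbig; rewrite leq_mul2l qk orbT.
have RF : 0 < R%:R :> F by rewrite ltr0n ltnW.
have R5 : R%:R ^+ 5 <= x%:R / (q ^ k)%N%:R :> F.
  by rewrite ler_pdivlMr // -natrX -natrM ler_nat.
have R4 : R%:R ^+ 4 <= x%:R / (q ^ k)%N%:R / ln R%:R :> F.
  rewrite ler_pdivlMr //; apply: le_trans R5; rewrite [X in _ <= X]exprSr ler_wpM2l ?exprn_ge0 //.
  by apply/ltW/ln_sublinear.
have hX : (x %/ q ^ k).+1%:R <= 2 * (x%:R / (q ^ k)%N%:R) :> F.
  have : ((x %/ q ^ k).+1 * q ^ k <= 2 * x)%N.
    apply: succ_div_mul_le; apply: leq_trans RBx.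
    by rewrite leq_pmull // expn_gt0 ltnW.
  by rewrite -(ler_nat F) !natrM mulrA ler_pdivlMr.
have -> : 9 * x%:R / ln R%:R / (q ^ k)%N%:R =
   4 * (2 * (x%:R / (q ^ k)%N%:R)) / ln R%:R + x%:R / (q ^ k)%N%:R / ln R%:R :> F by ring.
by apply: lerD => //; rewrite ler_wpM2r ?invr_ge0 ?(ltW lnR) // ler_pM2l.
Qed.

(** Markov's inequality. *)
Lemma smooth_count x Bd k : (0 < k)%N -> (R ^ 5 * Bd <= x)%N ->
  (\sum_(0 <= n < x | [&& prime n.+1, (R < n.+1)%N, small_prime_powers y Bd n & (y ^ k < smooth_part y n)%N]) 1)%N%:R <=
  36 * x%:R / (k%:R * ln R%:R) :> F.
Proof.
move=> k0 xbig.
have lny0 : 0 < ln y%:R :> F by apply: lt_le_trans lny.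
have kF : 0 < k%:R :> F by rewrite ltr0n.
rewrite -(ler_pM2r (mulr_gt0 kF lny0)).
have -> : 36 * x%:R / (k%:R * ln R%:R) * (k%:R * ln y%:R) = 36 * x%:R * ln y%:R / ln R%:R :> F.
  by field; rewrite !gt_eqF.
apply: le_trans (smooth_log_sum xbig).
rewrite natr_sum mulr_suml big_mkcond [X in _ <= X]big_mkcond; apply: ler_sum => n _.
have sp0 : (0 < smooth_part y n)%N by apply: part_gt0.
case: (prime _) => //=; case: (R < _)%N => //=; case: (small_prime_powers _ _ _) => //=.
case: ifP => h; last exact: ln_nat_ge0.
rewrite mul1r -ln_natX //; apply: ln_nat_le; [by rewrite expn_gt0 y0|exact: ltnW].
Qed.

Hypothesis L_ge1 : 1 <= L.
Hypothesis L_small : 17 * L <= y%:R.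

Let L0 : 0 < L. Proof. exact: lt_le_trans ltr01 L_ge1. Qed.

(** Union bound over [m]: [atypical_class_count] is used in the progression
    1 modulo [m], then [rough_sum_le]. *)
Lemma rough_pair_count x al be : (al <= be)%N -> (2 * be <= y)%N -> (R ^ 7 * y ^ be <= x)%N ->
  (\sum_(0 <= n < x | prime n.+1 && (R < n.+1)%N &&
     has (fun m => [&& rough m, (m %| n)%N & atypical (n %/ m)]) (index_iota (y ^ al) (y ^ be).+1)) 1)%N%:R
  <= 672 * x%:R * (be%:R - al%:R + 2) / (L * ln R%:R) :> F.
Proof.
move=> ab by2 xbig; apply: le_trans (count_has_le _ _ _ _) _.
have yal : (0 < y ^ al)%N by rewrite expn_gt0 y0.
apply: (@le_trans _ _ (\sum_(y ^ al <= m < (y ^ be).+1 | rough m) 672 * x%:R / (L * ln R%:R) * (m%:R : F)^-1)).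
  rewrite [X in _ <= X]big_mkcond [X in X <= _]big_nat_cond [X in _ <= X]big_nat_cond.
  apply: ler_sum => m /andP[/andP[ma mb] _]; rewrite ltnS in mb.
  have m0 : (0 < m)%N by apply: leq_trans ma.
  have mF : 0 < m%:R :> F by rewrite ltr0n.
  case: ifP => rm; last by rewrite big_pred0 // => n; rewrite andbF.
  have Rx : (R ^ 7 <= x %/ m)%N.
    by rewrite leq_divRL //; apply: leq_trans xbig; rewrite leq_mul2l mb orbT.
  have eu : euler_factor F (@prime_val R) [set i | prime_val i %| m]%N <= 2.
    apply: (@euler_factor_rough F R y m be) => //; apply: leq_ltn_trans mb _.
    by apply: (@leq_ltn_trans (y.+1 ^ be)); [case: (be) => // k; rewrite leq_exp2r|rewrite ltn_exp2l].
  have := @atypical_class_count F R y R1 y0 L_ge1 L_small m (x %/ m).+1 eu (leq_trans Rx (leqnSn _)).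
  set C := \sum_(0 <= e < _ | _) 1 => hC.
  apply: (@le_trans _ _ C%:R).
    rewrite ler_nat.
    have := count_multiples_reindex (fun n => [&& prime n.+1, (R < n.+1)%N & atypical (n %/ m)]) x m0.
    move=> h; apply: leq_trans (leq_trans h _).
      by apply: eq_leq; apply: eq_bigl => n; case: (prime _) => //=; case: (R < _)%N => //=; rewrite ?andbF.
    by apply: eq_leq; apply: eq_bigl => e; rewrite mulKn // addn1.
  apply: le_trans hC _.
  have hX : (x %/ m).+1%:R <= 2 * (x%:R / m%:R) :> F.
    have : ((x %/ m).+1 * m <= 2 * x)%N.
      apply: succ_div_mul_le; apply: leq_trans xbig; apply: leq_trans mb _.
      by rewrite leq_pmull // expn_gt0 ltnW.
    by rewrite -(ler_nat F) !natrM mulrA ler_pdivlMr.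
  have c0 : 0 <= (L * ln R%:R)^-1 :> F by rewrite invr_ge0 mulr_ge0 // ltW.
  have -> : 672 * x%:R / (L * ln R%:R) * m%:R^-1 = 336 * (2 * (x%:R / m%:R)) * (L * ln R%:R)^-1 by ring.
  rewrite -[X in _ <= X]mulrA -[X in X <= _]mulrA; apply: ler_wpM2l; first exact: ler0n.
  exact: ler_wpM2r c0 _ _ hX.
rewrite -mulr_sumr.
have -> : 672 * x%:R * (be%:R - al%:R + 2) / (L * ln R%:R) = 672 * x%:R / (L * ln R%:R) * (be%:R - al%:R + 2) by ring.
have c0 : 0 <= 672 * x%:R / (L * ln R%:R) :> F.
  exact: divr_ge0 (mulr_ge0 (ler0n _ _) (ler0n _ _)) (mulr_ge0 (ltW L0) (ltW lnR)).
move: (672 * _ / _) c0 => c c0; apply: ler_wpM2l c0 _ _ _.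
have lny0 : 0 < ln y%:R :> F by apply: lt_le_trans lny.
rewrite -(ler_pM2r lny0).
apply: le_trans (rough_sum_le F y1 yal _) _; first by rewrite leq_exp2l.
rewrite !ln_natX //; have := lny; lra.
Qed.

End Fixed.
End Counts.

(** * Cofactors in a factorization of a typical integer *)

Section Core.
Variables (F : realType) (R y : nat).
Local Notation L := (window_mass F R y).

Definition rough_part (n : nat) : nat := (n`_[pred q | (y < q)%N])%N.

Lemma rough_part_rough n : rough y (rough_part n).
Proof. exact: part_pnat. Qed.

Lemma smooth_rough n : (0 < n)%N -> (smooth_part y n * rough_part n = n)%N.
Proof.
move=> n0; rewrite mulnC -[RHS](partnC [pred q | (y < q)%N] n0); congr (_ * _)%N.
by apply: eq_partn => q; rewrite !inE leqNgt.
Qed.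

Lemma window_omegaM N M : (0 < N * M)%N -> (forall q, (y < q)%N -> prime q -> ~~ (q ^ 2 %| N * M)%N) ->
  window_omega R y (N * M) = (window_omega R y N + window_omega R y M)%N.
Proof.
move=> NM0 sq; rewrite /window_omega -big_split; apply: eq_bigr => i; rewrite inE => yi.
rewrite Euclid_dvdM ?prime_val_prime //=.
have := sq _ yi (prime_val_prime i); case: (boolP (prime_val i %| N)%N) => iN; case: (boolP (prime_val i %| M)%N) => iM //=.
by rewrite -mulnn dvdn_mul.
Qed.

Lemma window_omega_smooth N M : (0 < N)%N -> window_omega R y (smooth_part y N * M) = window_omega R y M.
Proof.
move=> N0; rewrite /window_omega; apply: eq_bigr => i; rewrite inE => yi.
rewrite Euclid_dvdM ?prime_val_prime //.
rewrite (_ : (prime_val i %| smooth_part y N)%N = false) //; apply/negP => d.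
have := part_pnat [pred q | (q <= y)%N] N.
rewrite /pnat => /andP[_ /allP/(_ (prime_val i))]; rewrite mem_primes prime_val_prime part_gt0 d => /(_ isT).
by rewrite inE leqNgt yi.
Qed.

(** Without square factors from the window, the number of prime factors in the
    window is additive, and [N * M %/ m1] has those of [M], [N * M %/ m2] those
    of [N].  If both were typical, each would exceed [3 * L / 4] and the product
    would have more than [5 * L / 4]. *)
Lemma atypical_factor N M k x : (0 < N)%N -> (0 < M)%N -> (N * M < x)%N ->
  ~~ has (fun q => (q ^ 2 %| N * M)%N) (index_iota y.+1 x) ->
  (smooth_part y (N * M) <= y ^ k)%N -> ~~ atypical F R y (N * M) -> 0 < L ->
  let m1 := rough_part N in let m2 := rough_part M in
  [/\ rough y m1, rough y m2, (m1 %| N * M)%N, (m2 %| N * M)%N &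
   [/\ (N <= y ^ k * m1)%N, (M <= y ^ k * m2)%N, (m1 <= N)%N, (m2 <= M)%N &
   atypical F R y (N * M %/ m1) \/ atypical F R y (N * M %/ m2)]].
Proof.
move=> N0 M0 NMx nosq sm typ L0 m1 m2.
have NM0 : (0 < N * M)%N by rewrite muln_gt0 N0.
have d1 : (m1 %| N)%N by apply: dvdn_part.
have d2 : (m2 %| M)%N by apply: dvdn_part.
have g1 : (0 < m1)%N by apply: part_gt0.
have g2 : (0 < m2)%N by apply: part_gt0.
have smdvd A : (A %| N * M)%N -> (smooth_part y A <= y ^ k)%N.
  move=> dA; apply: leq_trans sm; apply: dvdn_leq; first exact: part_gt0.
  exact: partn_dvd.
split; [exact: rough_part_rough|exact: rough_part_rough|exact: dvdn_mulr|exact: dvdn_mull|].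
split.
- by rewrite -[X in (X <= _)%N](smooth_rough N0) leq_mul2r smdvd ?orbT // dvdn_mulr.
- by rewrite -[X in (X <= _)%N](smooth_rough M0) leq_mul2r smdvd ?orbT // dvdn_mull.
- exact: dvdn_leq.
- exact: dvdn_leq.
have e1 : (N * M %/ m1 = smooth_part y N * M)%N.
  by rewrite -{1}(smooth_rough N0) mulnAC mulnK.
have e2 : (N * M %/ m2 = smooth_part y M * N)%N.
  by rewrite -{1}(smooth_rough M0) mulnA mulnK // mulnC.
rewrite e1 e2 /atypical !window_omega_smooth //.
have sq q : (y < q)%N -> prime q -> ~~ (q ^ 2 %| N * M)%N.
  move=> yq pq; apply/negP => d; move/negP: nosq; apply; apply/hasP; exists q => //.
  rewrite mem_index_iota yq /=; apply: leq_ltn_trans NMx; apply: dvdn_leq => //.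
  by apply: dvdn_trans d; rewrite -mulnn dvdn_mulr.
move: typ; rewrite /atypical window_omegaM // natrD -ltNge => typ.
apply/orP; rewrite -[_ || _]negbK negb_or -!ltNge; apply/negP => /andP[t1 t2].
move: typ t1 t2; rewrite !ltr_norml => /andP[_ a1] /andP[a2 _] /andP[a3 _]; lra.
Qed.
End Core.

(** * Counting the primes with a small generated subgroup *)

Lemma exponent_identities u K : (3 <= u)%N -> (K + 2 <= 8 * u)%N ->
  [/\ (16 * u - 2 = (8 * u - 1) + (8 * u - 1))%N,
      (16 * u + 1 + (8 * u - 2) = 24 * u - 1)%N,
      (16 * u - 2 + (8 * u + 3) = (24 * u).+1)%N,
      (K + (16 * u - 2 - K) = 16 * u - 2)%N &
      (K + (8 * u - 2 - K) = 8 * u - 2)%N].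
Proof. by move=> u3 Ku; split; lia. Qed.

Section MainCount.
Variables (F : realType) (a b : int).
Hypothesis a0 : a != 0.
Hypothesis b0 : b != 0.
Hypothesis indep : mult_independent [tuple a%:Q; b%:Q].
Variables (u K y : nat).
Hypothesis u3 : (3 <= u)%N.
Hypothesis K0 : (0 < K)%N.
Hypothesis Ku : (K + 2 <= 8 * u)%N.
Hypothesis yu : (40 * u <= y)%N.
Hypothesis lny : 1 <= ln (y%:R : F).
Local Notation R := (y ^ u)%N.
Local Notation L := (window_mass F R y).
Hypothesis L_ge1 : 1 <= L.
Hypothesis L_small : 17 * L <= y%:R.
Local Notation x := (2 * y ^ (24 * u))%N.

(** Primes up to [y ^ (24 * u - 1)] are few enough to be all counted; above, [p] is
    about [y ^ (24 * u)] and the bound on [pair_order] is slightly more than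
    [p ^ (2/3)]. *)
Definition small_pair_order (p : nat) : bool :=
  [&& prime p, ~~ (p%:Z %| (a * b)%R)%Z &
    (p <= y ^ (24 * u - 1))%N || (pair_order p a b <= y ^ (16 * u + 1))%N].

Let y0 : (0 < y)%N. Proof. by apply: leq_trans yu; rewrite muln_gt0 /= (leq_trans _ u3). Qed.
Let y2 : (2 <= y)%N. Proof. by apply: leq_trans yu; lia. Qed.
Let yX k : (0 < y ^ k)%N. Proof. by rewrite expn_gt0 y0. Qed.
Let R1 : (1 < R)%N.
Proof. by rewrite -[X in (X < _)%N](expn0 y) ltn_exp2l //; lia. Qed.

Let in_pairs n al be := prime n.+1 && (R < n.+1)%N &&
   has (fun m => [&& rough y m, (m %| n)%N & atypical F R y (n %/ m)]) (index_iota (y ^ al) (y ^ be).+1).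

(** Outside the first six cases, [N = pair_order] and [M = n / N] are within a
    few factors [y] of [y ^ (16 * u)] and [y ^ (8 * u)], their rough parts lose at
    most [y ^ K], and [atypical_factor] applies. *)
Lemma small_pair_order_cover n : (n < x)%N -> small_pair_order n.+1 ->
  [|| (n < y ^ (24 * u - 1))%N,
      [&& prime n.+1, ~~ (n.+1%:Z %| (a * b)%R)%Z & pair_order n.+1 a b < (y ^ (8 * u - 1)).+1 ^ 2]%N,
      (0 < n)%N && has (fun q => (q ^ 2 %| n)%N) (index_iota y.+1 x),
      (0 < n)%N && ~~ small_prime_powers y (y ^ 3) n,
      [&& prime n.+1, (R < n.+1)%N, small_prime_powers y (y ^ 3) n & (y ^ K < smooth_part y n)%N],
      [&& prime n.+1, (R < n.+1)%N & atypical F R y n],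
      in_pairs n (8 * u - 2 - K) (8 * u + 3) |
      in_pairs n (16 * u - 2 - K) (16 * u + 3)].
Proof.
move=> nx /and3P[pp pab small]; case: (ltnP n (y ^ (24 * u - 1))) => //= nbig.
case/orP: small => [h|Nle]; first by move: (leq_trans h nbig); rewrite ltnn.
rewrite /in_pairs pp pab /=; set N := pair_order _ _ _ in Nle *.
have Rn : (R < n.+1)%N by rewrite ltnS; apply: leq_trans nbig; rewrite leq_exp2l //; clear - u3; lia.
have n0 : (0 < n)%N by apply: leq_trans nbig.
rewrite Rn n0 /=; case: ltnP => //= Nbig.
have [//|nosq] := boolP (has _ (index_iota y.+1 x)).
case: (boolP (small_prime_powers _ _ _)) => //= gn.
case: (ltnP (y ^ K) (smooth_part y n)) => //= sm.
have [//|typ] := boolP (atypical F R y n).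
have N0 : (0 < N)%N by apply: pair_order_gt0.
have /dvdnP[M nE] : (N %| n)%N by have := pair_order_dvd_pred pp pab.
rewrite mulnC in nE.
have M0 : (0 < M)%N by move: n0; rewrite nE muln_gt0 => /andP[].
have L0 : 0 < L by apply: lt_le_trans L_ge1.
rewrite nE in nx nosq sm typ nbig *.
have [r1 r2 d1 d2 [N_le M_le m1N m2M at12]] := atypical_factor N0 M0 nx nosq sm typ L0.
have [ex1 ex2 ex3 ex4 ex5] := exponent_identities u3 Ku.
have yy k l : (y ^ k * y ^ l = y ^ (k + l))%N by rewrite expnD.
have Nlow : (y ^ (16 * u - 2) <= N)%N.
  apply: leq_trans Nbig; rewrite -[X in (_ <= X)%N]mulnn.
  by rewrite ex1 expnD leq_mul.
have Mlow : (y ^ (8 * u - 2) <= M)%N.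
  rewrite -(leq_pmul2l (yX (16 * u + 1))) yy ex2.
  by apply: leq_trans nbig _; rewrite leq_mul2r Nle orbT.
have Mup : (M <= y ^ (8 * u + 3))%N.
  rewrite -(leq_pmul2l (yX (16 * u - 2))) yy ex3.
  apply: (@leq_trans (N * M)); first by rewrite leq_mul2r Nlow orbT.
  by apply: leq_trans (ltnW nx) _; rewrite expnS leq_mul2r y2 orbT.
have m1low : (y ^ (16 * u - 2 - K) <= rough_part y N)%N.
  by rewrite -(leq_pmul2l (yX K)) yy ex4 (leq_trans Nlow).
have m2low : (y ^ (8 * u - 2 - K) <= rough_part y M)%N.
  by rewrite -(leq_pmul2l (yX K)) yy ex5 (leq_trans Mlow).
pose q m := [&& rough y m, (m %| N * M)%N & atypical F R y (N * M %/ m)].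
suff : has q (index_iota (y ^ (8 * u - 2 - K)) (y ^ (8 * u + 3)).+1) ||
       has q (index_iota (y ^ (16 * u - 2 - K)) (y ^ (16 * u + 3)).+1).
  by rewrite /q => ->.
case: at12 => at12; apply/orP; [right|left]; apply/hasP.
  exists (rough_part y N); last by rewrite /q r1 d1.
  by rewrite mem_index_iota m1low ltnS (leq_trans m1N) // (leq_trans Nle) // leq_exp2l // leq_add2l.
exists (rough_part y M); last by rewrite /q r2 d2.
by rewrite mem_index_iota m2low ltnS (leq_trans m2M).
Qed.

Lemma count_cover_le (P A0 A1 A2 A3 A4 A5 A6 A7 : pred nat) z :
  (forall n, (n < z)%N -> P n -> [|| A0 n, A1 n, A2 n, A3 n, A4 n, A5 n, A6 n | A7 n]) ->
  (\sum_(0 <= n < z | P n) 1)%N%:R <=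
  (\sum_(0 <= n < z | A0 n) 1)%N%:R + (\sum_(0 <= n < z | A1 n) 1)%N%:R +
  (\sum_(0 <= n < z | A2 n) 1)%N%:R + (\sum_(0 <= n < z | A3 n) 1)%N%:R +
  (\sum_(0 <= n < z | A4 n) 1)%N%:R + (\sum_(0 <= n < z | A5 n) 1)%N%:R +
  (\sum_(0 <= n < z | A6 n) 1)%N%:R + (\sum_(0 <= n < z | A7 n) 1)%N%:R :> F.
Proof.
move=> h; rewrite -!natrD ler_nat.
have cE (Q : pred nat) : (\sum_(0 <= n < z | Q n) 1 = \sum_(0 <= n < z) Q n)%N.
  by rewrite big_mkcond; apply: eq_bigr => n _; case: (Q n).
rewrite !cE -!big_split /= big_nat_cond [X in (_ <= X)%N]big_nat_cond.
apply: leq_sum => n /andP[/andP[_ nz] _]; case: (boolP (P n)) => // /(h n nz).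
by case: (A0 n); case: (A1 n); case: (A2 n); case: (A3 n); case: (A4 n); case: (A5 n); case: (A6 n); case: (A7 n).
Qed.

Lemma small_pair_order_count c : (`|a| <= 2 ^ c)%N -> (`|b| <= 2 ^ c)%N ->
  (\sum_(0 <= p < x | small_pair_order p) 1)%N%:R <=
  (y ^ (24 * u))%N%:R * ((7 + 16 * (1 + 2 * c%:R)) / y%:R +
     (72 / K%:R + (672 + 2688 * (K%:R + 7)) / L) / (u%:R * ln y%:R)) :> F.
Proof.
move=> ac bc; set Y := (y ^ (24 * u))%N.
have yF : 0 < y%:R :> F by rewrite ltr0n.
have yF1 : 1 <= y%:R :> F by rewrite ler1n.
have KF : 0 < K%:R :> F by rewrite ltr0n.
have lnR : 0 < ln (R%:R : F) by apply: ln_gt0; rewrite ltr1n R1.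
have L0 : 0 < L by apply: lt_le_trans L_ge1.
have xF : x%:R = 2 * Y%:R :> F by rewrite natrM.
rewrite -ln_natX //.
have YX k : (k <= 24 * u)%N -> (y ^ (24 * u - k))%N%:R = Y%:R / y%:R ^+ k :> F.
  move=> ku; apply/esym/eqP; rewrite eq_sym -natrX -[_ == _](inj_eq (mulIf (_ : (y ^ k)%N%:R != 0))).
    by rewrite divfK ?pnatr_eq0 -?lt0n // -natrM -expnD subnK.
  by rewrite pnatr_eq0 -lt0n.
have shift : (\sum_(0 <= p < x | small_pair_order p) 1 <= \sum_(0 <= n < x | small_pair_order n.+1) 1)%N.
  apply: (@leq_trans (\sum_(0 <= p < x.+1 | small_pair_order p) 1)%N).
    by rewrite [X in (_ <= X)%N](@big_cat_nat _ _ _ x) //= leq_addr.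
  by rewrite big_mkcond big_nat_recl //= -big_mkcond.
apply: le_trans (_ : (\sum_(0 <= n < x | small_pair_order n.+1) 1)%N%:R <= _); first by rewrite ler_nat.
apply: le_trans (count_cover_le small_pair_order_cover) _.
have YF : 0 <= Y%:R / y%:R :> F by rewrite divr_ge0.
have div_le k : (0 < k)%N -> Y%:R / y%:R ^+ k <= Y%:R / y%:R :> F.
  move=> k1; rewrite ler_wpM2l // lef_pV2 ?posrE ?exprn_gt0 //.
  by rewrite -[X in X <= _]expr1; apply: ler_weXn2l.
have c0 : (\sum_(0 <= n < x | (n < y ^ (24 * u - 1))%N) 1)%N%:R <= Y%:R / y%:R :> F.
  rewrite -[y%:R]expr1 -YX; last by clear - u3; lia.
  rewrite ler_nat sum1_count -size_filter -[X in (_ <= X)%N](size_iota 0).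
  apply: uniq_leq_size; first by rewrite filter_uniq // iota_uniq.
  by move=> n; rewrite mem_filter mem_iota /= add0n => /andP[].
have c1 : (\sum_(0 <= n < x | [&& prime n.+1, ~~ (n.+1%:Z %| (a * b)%R)%Z &
      pair_order n.+1 a b < (y ^ (8 * u - 1)).+1 ^ 2]%N) 1)%N%:R <=
   16 * (1 + 2 * c%:R) * (Y%:R / y%:R) :> F.
  have c1' := @small_order_count a b a0 b0 indep c (y ^ (8 * u - 1))%N x.+1 ac bc (yX _).
  rewrite big_mkcond big_nat_recl //= -big_mkcond /= add0n in c1'.
  apply: (@le_trans _ _ (8 * (1 + 2 * c) * (y ^ (8 * u - 1)) ^ 3 * 2)%N%:R); first by rewrite ler_nat.
  have -> : (8 * (1 + 2 * c) * (y ^ (8 * u - 1)) ^ 3 * 2 = 16 * (1 + 2 * c) * (y ^ (24 * u - 3)))%N.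
    rewrite -expnM; have -> : ((8 * u - 1) * 3 = 24 * u - 3)%N by clear - u3; lia.
    by clear - u3; lia.
  rewrite natrM YX; last by clear - u3; lia.
  rewrite natrM natrD natrM; apply: ler_wpM2l; last exact: div_le.
  exact: mulr_ge0 (ler0n _ _) (addr_ge0 ler01 (mulr_ge0 (ler0n _ _) (ler0n _ _))).
have c2 := @square_count F y y0 x.
have {}c2 : (\sum_(0 <= n < x | (0 < n)%N && has (fun q => (q ^ 2 %| n)%N) (index_iota y.+1 x)) 1)%N%:R
    <= 2 * (Y%:R / y%:R) :> F by rewrite mulrA -xF.
have c3 : (\sum_(0 <= n < x | (0 < n)%N && ~~ small_prime_powers y (y ^ 3) n) 1)%N%:R <= 4 * (Y%:R / y%:R) :> F.
  apply: le_trans (@large_prime_power_count F y y0 x _ (yX 3)) _.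
  rewrite xF natrX; have -> : 2 * y%:R * (2 * Y%:R) / y%:R ^+ 3 = 4 * (Y%:R / y%:R ^+ 2) :> F.
    by field; rewrite gt_eqF.
  apply: ler_wpM2l; first exact: ler0n.
  exact: div_le.
have R5 : (R ^ 5 * y ^ 3 <= x)%N.
  rewrite -expnM -expnD; apply: (@leq_trans (y ^ (24 * u))%N); last by rewrite leq_pmull.
  by rewrite leq_exp2l //; clear - u3; lia.
have c4 := smooth_count R1 lny K0 R5.
have R7 : (R ^ 7 <= x)%N.
  rewrite -expnM; apply: (@leq_trans (y ^ (24 * u))%N); last by rewrite leq_pmull.
  by rewrite leq_exp2l //; clear - u3; lia.
have eu1 : euler_factor F (@prime_val R) [set i | prime_val i %| 1]%N <= 2.
  by have := @euler_factor_prime_power F R 2 0 isT; rewrite expn0.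
have c5 : (\sum_(0 <= n < x | [&& prime n.+1, (R < n.+1)%N & atypical F R y n]) 1)%N%:R <=
    336 * x%:R / (L * ln R%:R) :> F.
  apply: le_trans (@atypical_class_count F R y R1 y0 L_ge1 L_small 1 x eu1 R7).
  by rewrite ler_nat; apply: eq_leq; apply: eq_bigl => n; rewrite mul1n addn1.
have c67 al be : (al <= be)%N -> (be <= 16 * u + 3)%N -> (be = al + (K + 5))%N ->
   (\sum_(0 <= n < x | in_pairs n al be) 1)%N%:R <= 672 * x%:R * (K%:R + 7) / (L * ln R%:R) :> F.
  move=> ab beu bea.
  have by2 : (2 * be <= y)%N by apply: leq_trans yu; clear - u3 beu; lia.
  have xb : (R ^ 7 * y ^ be <= x)%N.
    rewrite -expnM -expnD; apply: (@leq_trans (y ^ (24 * u))%N); last by rewrite leq_pmull.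
    by rewrite leq_exp2l //; clear - u3 beu; lia.
  have := rough_pair_count R1 lny L_ge1 L_small ab by2 xb.
  have -> : be%:R - al%:R + 2 = K%:R + 7 :> F by rewrite bea !natrD; ring.
  by [].
have c6 : (\sum_(0 <= n < x | in_pairs n (8 * u - 2 - K) (8 * u + 3)) 1)%N%:R <=
   672 * x%:R * (K%:R + 7) / (L * ln R%:R) :> F by apply: c67; clear - u3 Ku; lia.
have c7 : (\sum_(0 <= n < x | in_pairs n (16 * u - 2 - K) (16 * u + 3)) 1)%N%:R <=
   672 * x%:R * (K%:R + 7) / (L * ln R%:R) :> F by apply: c67; clear - u3 Ku; lia.
have e4 : 36 * x%:R / (K%:R * ln R%:R) = Y%:R * ((72 / K%:R) / ln R%:R) :> F.
  by rewrite xF; field; rewrite !gt_eqF.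
have e5 : 336 * x%:R / (L * ln R%:R) = Y%:R * (672 / L / ln R%:R) :> F.
  by rewrite xF; field; rewrite !gt_eqF.
have e6 : 672 * x%:R * (K%:R + 7) / (L * ln R%:R) = Y%:R * (1344 * (K%:R + 7) / L / ln R%:R) :> F.
  by rewrite xF; field; rewrite !gt_eqF.
rewrite e4 in c4; rewrite e5 in c5; rewrite e6 in c6 c7.
have -> : Y%:R * ((7 + 16 * (1 + 2 * c%:R)) / y%:R + (72 / K%:R + (672 + 2688 * (K%:R + 7)) / L) / ln R%:R) =
  Y%:R / y%:R + 16 * (1 + 2 * c%:R) * (Y%:R / y%:R) + 2 * (Y%:R / y%:R) + 4 * (Y%:R / y%:R) +
  Y%:R * ((72 / K%:R) / ln R%:R) + Y%:R * (672 / L / ln R%:R) +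
  Y%:R * (1344 * (K%:R + 7) / L / ln R%:R) + Y%:R * (1344 * (K%:R + 7) / L / ln R%:R) :> F.
  by field; rewrite !gt_eqF.
exact: lerD (lerD (lerD (lerD (lerD (lerD (lerD c0 c1) c2) c3) c4) c5) c6) c7.
Qed.
End MainCount.

(** * Passage to the limit *)

Section Limit.
Variable F : realType.

Lemma ln_sublinear_eventually (d : F) : 0 < d ->
  exists y0 : nat, forall y, (y0 <= y)%N -> ln (y%:R : F) <= d * y%:R.
Proof.
move=> d0; exists (Num.truncn (4 / d ^+ 2)).+1 => y yy.
have yF : 4 / d ^+ 2 <= y%:R.
  apply/ltW/(lt_le_trans (truncnS_gt _)); by rewrite ler_nat.
have y0 : 0 < y%:R :> F by rewrite ltr0n; apply: leq_trans yy.
set s := Num.sqrt (y%:R : F); have s0 : 0 < s by rewrite sqrtr_gt0.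
have sE : y%:R = s ^+ 2 by rewrite sqr_sqrtr // ltW.
have sd : 2 <= d * s.
  rewrite -(@ler_pXn2r _ 2) ?nnegrE ?mulr_ge0 ?(ltW d0) ?(ltW s0) //.
  move: yF; rewrite sE ler_pdivrMr ?exprn_gt0 // exprMn mulrC; lra.
have ls := ln_sublinear s0.
rewrite sE lnXn // -mulr_natl; nra.
Qed.

Lemma ln_eventually_ge (t : F) :
  exists y0 : nat, forall y, (y0 <= y)%N -> t <= ln (y%:R : F).
Proof.
exists (Num.truncn (expR t)).+1 => y yy.
have y0 : 0 < y%:R :> F by rewrite ltr0n; apply: leq_trans yy.
rewrite -[t]expRK ler_ln ?posrE ?expR_gt0 //.
by apply/ltW/(lt_le_trans (truncnS_gt _)); rewrite ler_nat.
Qed.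

(** The largest [y] with [y ^ B <= x] works, because [(1 + 1 / y) ^ B <= 2]. *)
Lemma integer_root_exists B y0 (x : F) : (0 < B)%N -> (0 < y0)%N -> (2 * B <= y0)%N ->
  (y0 ^ B)%N%:R <= x ->
  exists y, [/\ (y0 <= y)%N, (y ^ B)%N%:R <= x & x < (2 * y ^ B)%N%:R].
Proof.
move=> B0 y00 By hx; have x0 : 0 <= x by apply: le_trans hx.
have geP k : ((k ^ B)%N%:R <= x) = (k ^ B <= Num.truncn x)%N by rewrite truncn_ge_nat.
have ex : exists k, (k ^ B <= Num.truncn x)%N by exists y0; rewrite -geP.
have ub k : (k ^ B <= Num.truncn x)%N -> (k <= Num.truncn x)%N.
  apply: leq_trans; case: k => // k; rewrite -[X in (X <= _)%N]expn1.
  by case: k => [|k]; [rewrite !exp1n|rewrite leq_exp2l].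
case: (ex_maxnP ex ub) => y yx ymax.
have yy : (y0 <= y)%N by apply: ymax; rewrite -geP.
exists y; split; rewrite ?geP //.
have : ~~ ((y.+1 ^ B)%N%:R <= x) by rewrite geP; apply/negP => /ymax; rewrite ltnn.
rewrite -ltNge => /lt_le_trans; apply.
have yF : 0 < y%:R :> F by rewrite ltr0n (leq_trans y00).
have -> : (y.+1 ^ B)%N%:R = y%:R ^+ B * (1 + y%:R^-1) ^+ B :> F.
  by rewrite natrX -exprMn mulrDr mulr1 divff ?gt_eqF // natr1.
rewrite natrM natrX mulrC ler_pM2r ?exprn_gt0 //.
have h : 2 * B%:R * y%:R^-1 <= 1 :> F.
  by rewrite ler_pdivrMr // mul1r -natrM ler_nat (leq_trans By).
have := @expr1D_le F y%:R^-1 B; rewrite invr_ge0 ler0n => /(_ isT h); lra.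
Qed.

Lemma ln_five_orders_ge (a b : int) p : prime p -> ~~ (p%:Z %| (a * b)%R)%Z ->
  4 * ln ((pair_order p a b)%:R : F) <= 10 * ln 6%:R +
  (ln (mult_order p a)%:R + ln (mult_order p b)%:R + ln (mult_order p (a * b))%:R +
   ln (mult_order p (a ^+ 2 * b))%:R + ln (mult_order p (a * b ^+ 2))%:R).
Proof.
move=> pp pab; have N0 := pair_order_gt0 p a b.
have o0 c : (0 < mult_order p c)%N by apply: order_gt0.
have N4 : (0 < pair_order p a b ^ 4)%N by rewrite expn_gt0 N0.
have := ln_nat_le F N4 (prod_five_orders_ge pp pab).
rewrite ln_natX // ln_natM ?expn_gt0 //; last by rewrite prodn_gt0.
rewrite ln_natX // !big_cons big_nil muln1 !ln_natM ?muln_gt0 ?o0 //.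
by rewrite !addrA.
Qed.

(** Take logarithms in [prod_five_orders_ge]: five times [8/15] of [24 * u] is four
    times [16 * u]; [eps] contributes at most [ln y], and the constants are
    absorbed in [ln y >= 20]. *)
Lemma small_orders_small_pair (a b : int) p u y (eps : F) :
  prime p -> ~~ (p%:Z %| (a * b)%R)%Z -> (0 < u)%N -> (0 < y)%N ->
  (p <= 2 * y ^ (24 * u))%N -> 0 <= eps -> eps * (120 * u%:R) <= 1 -> 20 <= ln (y%:R : F) ->
  (forall c, c \in [:: a; b; a * b; a ^+ 2 * b; a * b ^+ 2] ->
     (mult_order p c)%:R <= p%:R `^ (8 / 15 + eps)) ->
  (pair_order p a b <= y ^ (16 * u + 1))%N.
Proof.
move=> pp pab u0 y0 py eps0 epsu lny small.
set N := pair_order p a b; have N0 : (0 < N)%N by apply: pair_order_gt0.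
have p0 : (0 < p)%N := prime_gt0 pp.
have ln2 : ln (2%:R : F) <= 1.
  by have := @ln_succ_le F 1 isT; rewrite ln1 subr0 invr1.
have ln6 : ln (6%:R : F) <= 5.
  apply: (@le_trans _ _ (ln (2 ^ 3)%N%:R)); first exact: ln_nat_le.
  rewrite ln_natX //; lra.
have lp : ln (p%:R : F) <= 1 + (24 * u)%N%:R * ln y%:R.
  apply: le_trans (ln_nat_le F p0 py) _.
  by rewrite ln_natM ?expn_gt0 ?y0 // ln_natX // lerD2r.
have lp0 := ln_nat_ge0 F p.
have lo c : c \in [:: a; b; a * b; a ^+ 2 * b; a * b ^+ 2] ->
    ln ((mult_order p c)%:R : F) <= (8 / 15 + eps) * ln p%:R.
  move=> /small h; rewrite -ln_powR ler_ln ?posrE ?powR_gt0 ?ltr0n ?order_gt0 //.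
have hN := ln_five_orders_ge pp pab; rewrite -/N in hN.
have h1 := lo a; have h2 := lo b; have h3 := lo (a * b).
have h4 := lo (a ^+ 2 * b); have h5 := lo (a * b ^+ 2).
rewrite !inE !(eqxx, orbT) in h1 h2 h3 h4 h5.
move: (h1 isT) (h2 isT) (h3 isT) (h4 isT) (h5 isT) => {}h1 {}h2 {}h3 {}h4 {}h5.
have e1 : eps * (u%:R * ln y%:R) * 120 <= ln y%:R.
  have : eps * (120 * u%:R) * ln y%:R <= 1 * ln y%:R by apply: ler_wpM2r => //; lra.
  lra.
have eps1 : eps <= 1.
  have : 1 <= u%:R :> F by rewrite ler1n.
  nra.
have l1 : (8 / 15 + eps) * ln p%:R <= (8 / 15 + eps) * (1 + (24 * u)%N%:R * ln y%:R).
  by apply: ler_wpM2l => //; lra.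
rewrite natrM in l1.
have fin : ln (N%:R : F) <= (16 * u + 1)%N%:R * ln y%:R.
  rewrite natrD natrM; lra.
rewrite -(ler_nat F) -ler_ln ?posrE ?ltr0n ?expn_gt0 ?y0 //.
by rewrite ln_natX.
Qed.
End Limit.

(** Multiplied by [25 * u * ln y], an upper bound for [ln x], the bound of
    [small_pair_order_count] has one term in [ln y / y] and two terms of sizes
    [1 / K] and [K / L]. *)
Lemma parameters_exist (F : realType) (a b : int) (a0 : a != 0) (b0 : b != 0)
    (indep : mult_independent [tuple a%:Q; b%:Q]) (e : F) : 0 < e ->
  exists2 u : nat, (0 < u)%N & exists y0 : nat, forall y : nat, (y0 <= y)%N ->
    (\sum_(0 <= p < 2 * y ^ (24 * u) | small_pair_order a b u y p) 1)%N%:R *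
      (25 * u%:R * ln (y%:R : F)) <= e * (y ^ (24 * u))%N%:R.
Proof.
move=> e0.
(* [25 * 72 / K <= e / 3] *)
pose K := (Num.truncn (5400 / e)).+1.
have KF : 0 < K%:R :> F by rewrite ltr0n.
have hK : 25 * (72 / K%:R) <= e / 3.
  have : 5400 / e < K%:R by apply: truncnS_gt.
  rewrite ltr_pdivrMr // => h; rewrite mulrA ler_pdivrMr //; lra.
pose W : F := 25 * (672 + 2688 * (K%:R + 7)).
have W0 : 0 < W by rewrite /W; lra.
(* As [L >= 3 * J / 16], this gives [L >= 1] and [W / L <= e / 3]; [K <= J] bounds
   [K] by [u]. *)
pose J := (maxn 6 (maxn K (Num.truncn (16 * W / e)).+1)).
have J6 : (6 <= J)%N by rewrite /J leq_maxl.
have JK : (K <= J)%N by rewrite /J leq_max leq_maxl orbT.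
have JW : 16 * W / e <= J%:R.
  apply/ltW/(lt_le_trans (truncnS_gt _)); by rewrite ler_nat /J !leq_max leqnn !orbT.
pose u := (8 ^ J)%N.
have Ju : (J < u)%N by apply: ltn_expl.
have u0 : (0 < u)%N by apply: leq_ltn_trans Ju.
have uF : 0 < u%:R :> F by rewrite ltr0n.
exists u => //.
pose c := (`|a| + `|b|)%N.
have ac : (`|a| <= 2 ^ c)%N by apply: leq_trans (ltnW (ltn_expl _ _)); rewrite ?leq_addr.
have bc : (`|b| <= 2 ^ c)%N by apply: leq_trans (ltnW (ltn_expl _ _)); rewrite ?leq_addl.
pose D : F := 25 * u%:R * (7 + 16 * (1 + 2 * c%:R)).
have cF : 0 <= c%:R :> F by [].
have D0 : 0 < D by rewrite /D !mulr_gt0 //; lra.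
have d1 : 0 < e / (3 * D) by rewrite divr_gt0 // mulr_gt0.
have d2 : 0 < (34 * u%:R)^-1 :> F by rewrite invr_gt0 mulr_gt0.
have [y1 hy1] := ln_sublinear_eventually d1.
have [y2 hy2] := ln_sublinear_eventually d2.
have [y3 hy3] := @ln_eventually_ge F 1.
exists (maxn (40 * u) (maxn y1 (maxn y2 y3))) => y; rewrite !geq_max => /and4P[yu /hy1 {}hy1 /hy2 {}hy2 /hy3 lny].
have y0 : (0 < y)%N by apply: leq_trans yu; rewrite muln_gt0.
have yF : 0 < y%:R :> F by rewrite ltr0n.
have y4 : (4 <= y)%N by apply: leq_trans yu; rewrite (leq_trans _ (leq_pmulr _ u0)).
have LJ : J%:R * (3 / 16) <= window_mass F (y ^ u) y.
  by rewrite window_massE; apply: window_mass_ge.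
have L1 : 1 <= window_mass F (y ^ u) y.
  apply: le_trans LJ; have : 6 <= J%:R :> F by rewrite ler_nat.
  lra.
have Ls : 17 * window_mass F (y ^ u) y <= y%:R.
  have := window_mass_le F y0 (_ : 0 < y ^ u)%N; rewrite expn_gt0 y0 => /(_ isT); rewrite ln_natX //.
  have h34 : 34 <= y%:R :> F.
    by rewrite ler_nat; apply: leq_trans yu; rewrite (leq_trans _ (leq_pmulr _ u0)).
  have : u%:R * ln y%:R * 34 <= y%:R :> F.
    move: hy2; rewrite ler_pdivlMl ?mulr_gt0 //; lra.
  lra.
have u3 : (3 <= u)%N by apply: leq_trans (ltnW Ju); apply: leq_trans J6.
have Ku : (K + 2 <= 8 * u)%N by clear - JK Ju J6; lia.
have main := small_pair_order_count a0 b0 indep u3 (ltn0Sn _ : 0 < K)%N Ku yu lny L1 Ls ac bc.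
set Y := (y ^ (24 * u))%N in main *.
set N := (\sum_(0 <= p < _ | _) 1)%N in main *.
set L := window_mass F _ _ in L1 LJ main.
have l0 : 0 < ln y%:R :> F by apply: lt_le_trans lny.
have L0 : 0 < L by apply: lt_le_trans L1.
have ul0 : 0 <= 25 * u%:R * ln y%:R :> F by rewrite !mulr_ge0 // ltW.
apply: le_trans (ler_wpM2r ul0 main) _.
have hL : W / L <= e / 3.
  rewrite ler_pdivrMr //; move: JW; rewrite ler_pdivrMr // => JW.
  have : e * (J%:R * (3 / 16)) <= e * L by rewrite ler_pM2l.
  lra.
have hy : D * ln y%:R / y%:R <= e / 3.
  rewrite ler_pdivrMr //; move: hy1; rewrite -(ler_pM2l D0).
  have -> : D * (e / (3 * D) * y%:R) = e / 3 * y%:R by field; rewrite gt_eqF.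
  by [].
have -> : Y%:R * ((7 + 16 * (1 + 2 * c%:R)) / y%:R +
    (72 / K%:R + (672 + 2688 * (K%:R + 7)) / L) / (u%:R * ln y%:R)) * (25 * u%:R * ln y%:R) =
    Y%:R * (D * ln y%:R / y%:R + 25 * (72 / K%:R) + W / L).
  by rewrite /D /W; field; rewrite !gt_eqF.
rewrite mulrC ler_wpM2r //; lra.
Qed.

Local Open Scope classical_set_scope.
Local Open Scope ring_scope.

Theorem mainTheorem2 (R : realType) (eps : R -> R)
    (eps_gt0 : forall x : R, 2 <= x -> 0 < eps x)
    (eps_cvg0 : eps x @[x --> +oo] --> (0 : R))
    (a b : int) (a_neq0 : a != 0) (b_neq0 : b != 0)
    (ab_indep : mult_independent [tuple a%:Q; b%:Q]) :
  for_almost_all_primes R (fun p : nat =>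
    ~~ (p%:Z %| a * b)%Z ->
    exists2 c : int, c \in [:: a; b; a * b; a ^+ 2 * b; a * b ^+ 2]
      & p%:R `^ (8 / 15 + eps p%:R) < (mult_order p c)%:R).
Proof.
set P := fun p : nat => _; apply/cvgrPdist_le => e e0.
have [u u0 [y1 count_le]] := parameters_exist a_neq0 b_neq0 ab_indep e0.
have uF : 0 < u%:R :> R by rewrite ltr0n.
(* one fifth of the inverse of the exponent [24 * u]: the factor [p ^ (5 * eps)] is
   about [y] at most *)
have d0 : 0 < (120 * u%:R)^-1 :> R by rewrite invr_gt0 mulr_gt0.
have /cvgrPdist_le/(_ _ d0)[M [_ epsM]] := eps_cvg0.
have [y2 ln_ge] := @ln_eventually_ge R 20.
(* [48 * u] is twice the exponent [24 * u], as [integer_root_exists] asks *)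
pose y0 := maxn (48 * u) (maxn y1 (maxn y2 (Num.truncn M).+1)).
have uy0 : (48 * u <= y0)%N by apply: leq_maxl.
have y0_gt0 : (0 < y0)%N by apply: leq_trans uy0; rewrite muln_gt0.
near=> x.
have x_ge : (y0 ^ (24 * u))%N%:R <= x by near: x; apply: nbhs_pinfty_ge; rewrite num_real.
have B0 : (0 < 24 * u)%N by rewrite muln_gt0.
have By : (2 * (24 * u) <= y0)%N by rewrite mulnA.
have [y [y0y Yx xY]] := integer_root_exists B0 y0_gt0 By x_ge.
move: y0y; rewrite !geq_max => /and4P[yu /count_le {}count_le /ln_ge lny yM].
have y_gt0 : (0 < y)%N by apply: leq_trans yu; rewrite muln_gt0.
have y_gt1 : (1 < y)%N by apply: leq_trans yu; rewrite (leq_trans _ (leq_pmulr _ u0)).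
set Y := (y ^ (24 * u))%N in count_le Yx xY.
have Y_gt0 : (0 < Y)%N by rewrite expn_gt0 y_gt0.
have YF : 0 < Y%:R :> R by rewrite ltr0n.
have x_gt0 : 0 < x by apply: lt_le_trans Yx.
have x_gt1 : 1 < x.
  apply: lt_le_trans Yx; rewrite ltr1n; apply: (leq_trans y_gt1).
  by rewrite /Y -[X in (X <= _)%N]expn1 leq_exp2l.
have lnx_gt0 : 0 < ln x by apply: ln_gt0.
have lnx_le : ln x <= 25 * u%:R * ln y%:R.
  apply: (@le_trans _ _ (ln (y ^ (25 * u))%N%:R)); last by rewrite ln_natX // natrM.
  rewrite ler_ln ?posrE ?ltr0n ?expn_gt0 ?y_gt0 //; apply: le_trans (ltW xY) _.
  rewrite ler_nat; apply: (@leq_trans (y * Y)); first by rewrite leq_mul2r y_gt1 orbT.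
  by rewrite -expnS leq_exp2l // -[25%N]/(24.+1) mulSn -add1n leq_add2r.
rewrite sub0r normrN ger0_norm; last by rewrite divr_ge0 // divr_ge0 // ltW.
rewrite ler_pdivrMr ?divr_gt0 // mulrA ler_pdivlMr //.
apply: (@le_trans _ _ (e * Y%:R)); last by rewrite ler_pM2l.
apply: le_trans count_le; apply: ler_pM => //; first exact: ltW.
rewrite ler_nat /exceptional_count.
have -> n : iota 0 n = index_iota 0 n by rewrite /index_iota subn0.
rewrite -sum1_count.
have xT : ((Num.truncn x).+1 <= 2 * Y)%N by rewrite truncn_lt_nat // ltW.
rewrite [X in (_ <= X)%N](@big_cat_nat _ _ _ (Num.truncn x).+1) //=.
apply: (leq_trans _ (leq_addr _ _)).
rewrite [X in (X <= _)%N]big_mkcond [X in (_ <= X)%N]big_mkcond /=.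
rewrite [X in (X <= _)%N]big_nat [X in (_ <= X)%N]big_nat; apply: leq_sum => p /andP[_ px].
case: ifP => // /andP[pp /asboolPn nP].
rewrite ifT //; apply/and3P; split => //.
  by apply/negP => dab; apply: nP; rewrite /P dab.
have [//|p_big /=] := leqP p (y ^ (24 * u - 1)).
have pab : ~~ (p%:Z %| a * b)%Z by apply/negP => dab; apply: nP; rewrite /P dab.
have epsp : eps p%:R <= (120 * u%:R)^-1.
  have Mp : M < p%:R.
    apply: lt_le_trans (truncnS_gt _) _; rewrite ler_nat; apply: leq_trans yM _.
    apply: leq_trans (ltnW p_big); rewrite -[X in (X <= _)%N]expn1 leq_exp2l //.
    by rewrite subn_gt0 (leq_trans _ (leq_pmulr _ u0)).
  have := epsM _ Mp; rewrite /= sub0r normrN; apply: le_trans; exact: ler_norm.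
apply: (@small_orders_small_pair R a b p u y (eps p%:R)) => //.
- by rewrite (leq_trans _ xT) // ltnW.
- by apply/ltW/eps_gt0; rewrite ler_nat prime_gt1.
- by rewrite -ler_pdivlMr ?mulr_gt0 // mul1r.
move=> c cin; rewrite leNgt; apply/negP => big_order; apply: nP => _.
by exists c.
Unshelve. all: by end_near.
Qed.
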